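(* Let $\alpha,\beta\ge0$. The product measure $\mu^{\mathbb{Z}}$ satisfies $\mathcal{T}^{(\alpha,\beta)}_{dK}\mu^{\mathbb{Z}}=\mu^{\mathbb{Z}}$ for the following $\mu$: (a) if $\alpha=\beta$: any probability measure $\mu$ on $(0,\infty)$; (b) if $\alpha>0$, $\beta=0$: $\mu=\mathrm{GIG}(\lambda,c\alpha,c)$ for any $\lambda,c>0$ such that $2\int\log(x)\,\mu(dx)<-\log\alpha$; (c) if $\alpha=0$, $\beta>0$: $\mu=\mathrm{IG}(\lambda,c)$ for any $\lambda,c>0$ such that $2\int\log(x)\,\mu(dx)<-\log\beta$.
   Context: $F^{(\alpha,\beta)}_{dK}(x,u):=\left(\frac{u(1+\beta xu)}{1+\alpha xu},\frac{x(1+\alpha xu)}{1+\beta xu}\right)$ on $(0,\infty)^2$, an involution. The dynamics $\mathcal{T}^{(\alpha,\beta)}_{dK}$ on $(0,\infty)^{\mathbb{Z}}$: for configurations $x=(x_n)$ for which either there is a unique family $(x_n^t,u_n^t)_{n,t\in\mathbb{Z}}$ with $F^{(\alpha,\beta)}_{dK}(x_n^t,u_{n-1}^t)=(x_n^{t+1},u_n^t)$ for all $n,t$ and $x_n^0=x_n$, or a unique sequence $(U_n)\in(0,\infty)^{\mathbb{Z}}$ with $(F^{(\alpha,\beta)}_{dK})^{(2)}(x_n,U_{n-1})=U_n$ for all $n$, set $\mathcal{T}(x)_n:=(F^{(\alpha,\beta)}_{dK})^{(1)}(x_n,U_{n-1})$ (with $U_n=u_n^0$); invariance includes that $\mathcal{T}$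 is a.s. defined. $\mathrm{GIG}(\lambda,c_1,c_2)$ has density proportional to $x^{-\lambda-1}e^{-c_1x-c_2x^{-1}}$ on $(0,\infty)$; $\mathrm{IG}(\lambda,c)$ has density proportional to $x^{-\lambda-1}e^{-cx^{-1}}$ on $(0,\infty)$. *)

(* Defs.v *)
From HB Require Import structures.
From mathcomp Require Import all_boot all_order all_algebra.
From mathcomp Require Import all_classical all_reals all_analysis.

Set Implicit Arguments.
Unset Strict Implicit.
Unset Printing Implicit Defensive.

Import Order.TTheory GRing.Theory Num.Theory.
Local Open Scope classical_set_scope.
Local Open Scope ring_scope.

Section dK.
Variable R : realType.

(* The map F^{(a,b)}_{dK}(x,u), used only on (0,oo)^2. *)
Definition F_dK (a b : R) (x u : R) : R * R :=
  (u * (1 + b * x * u) / (1 + a * x * u), x * (1 + a * x * u) / (1 + b * x * u)).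

Definition cfg := int -> R.
HB.instance Definition _ := gen_eqMixin cfg.
HB.instance Definition _ := gen_choiceMixin cfg.
HB.instance Definition _ := isPointed.Build cfg (fun _ => 0%R).

Definition coord_gen : set (set cfg) :=
  [set C | exists (n : int) (B : set R), measurable B /\ C = (fun x => x n) @^-1` B].


Definition Config : measurableType (sigma_display coord_gen) := g_sigma_algebraType coord_gen.

Definition pos_config (x : int -> R) := forall n, 0 < x n.

Definition dK_family (a b : R) (x : int -> R) (X U : int -> int -> R) :=
  (forall n t, 0 < X n t /\ 0 < U n t) /\
  (forall n t, F_dK a b (X n t) (U (n - 1)%R t) = (X n (t + 1)%R, U n t)) /\
  (forall n, X n 0 = x n).

Definition dK_carrier (a b : R) (x : int -> R) (U : int -> R) :=
  (forall n, 0 < U n) /\ (forall n, (F_dK a b (x n) (U (n - 1)%R)).2 = U n).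

Definition unique_family a b x :=
  exists! p : (int -> int -> R) * (int -> int -> R), dK_family a b x p.1 p.2.

Definition unique_carrier a b x := exists! U : int -> R, dK_carrier a b x U.

Definition T_dK_dom (a b : R) (x : int -> R) :=
  pos_config x /\ (unique_family a b x \/ unique_carrier a b x).

(* The sequence U used to define T_dK(x): U_n = u_n^0 if a unique family
   exists, otherwise the unique carrier (junk value outside the domain). *)
Definition dK_U (a b : R) (x : int -> R) : int -> R :=
  if `[< unique_family a b x >] then
    (fun n => (xget ((fun _ _ => 1), (fun _ _ => 1))
                 [set p | dK_family a b x p.1 p.2]).2 n 0)
  else xget (fun _ => 1) [set U | dK_carrier a b x U].

Definition T_dK (a b : R) (x : int -> R) : int -> R :=
  fun n => (F_dK a b (x n) (dK_U a b x (n - 1)%R)).1.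

Definition cylinder k (n : 'I_k -> int) (A : 'I_k -> set R) : set Config :=
  [set x | forall i, A i (x (n i))].

(* P is the product measure mu^Z (characterised on cylinders, which form a
   pi-system generating the product sigma-algebra). *)
Definition iid_law (P : set Config -> \bar R) (mu : set R -> \bar R) :=
  forall k (n : 'I_k -> int) (A : 'I_k -> set R),
    injective n -> (forall i, measurable (A i)) ->
    P (cylinder n A) = (\prod_(i < k) mu (A i))%E.

(* T_dK P = P, including that T_dK is P-a.s. defined: there is a measurable
   set E of full measure inside the domain on which T_dK is measurable
   (w.r.t. cylinders) and pushes P forward to P. *)
Definition dK_invariant (a b : R) (P : set Config -> \bar R) :=
  exists E : set Config,
    [/\ measurable E, P E = 1%E, (forall x, E x -> T_dK_dom a b x) &
    forall k (n : 'I_k -> int) (A : 'I_k -> set R),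
      (forall i, measurable (A i)) ->
      measurable (E `&` (T_dK a b @^-1` cylinder n A)) /\
      P (E `&` (T_dK a b @^-1` cylinder n A)) = P (cylinder n A)].

Definition has_density_prop (mu : set R -> \bar R) (g : R -> R) :=
  exists kappa : R, 0 < kappa /\
    forall A : set R, measurable A ->
      mu A = (kappa%:E * \int[@lebesgue_measure R]_(x in A `&` [set y : R | (0 < y)%R]) (g x)%:E)%E.

Definition GIG_density (lam c1 c2 : R) (x : R) : R :=
  x `^ (- lam - 1) * expR (- (c1 * x) - c2 / x).

Definition IG_density (lam c : R) (x : R) : R :=
  x `^ (- lam - 1) * expR (- (c / x)).

Definition log_moment_cond (mu : set R -> \bar R) (r : R) :=
  (2%:E * \int[mu]_x (ln x)%:E < (- ln r)%:E)%E.

End dK.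

(* Main.v *)
Require Import Defs.
From HB Require Import structures.
From mathcomp Require Import all_boot all_order all_algebra.
From mathcomp Require Import all_classical all_reals all_analysis.
From mathcomp Require Import measurable_realfun.
From mathcomp Require Import ring lra zify.

(** The map F preserves a product measure mu x nu, where (mu, nu) = (GIG, IG) in
    case (b) and (IG, GIG) in case (c): with s = xu, F is a composition of
    dilations in one variable, and so preserves the product of the measures
    dx/x and du/u.  If a carrier U depends only on the past and U_n has law nu, then
    Burke's argument (apply F site by site) shows that the transported
    configuration is again i.i.d. with law mu.

    Run the carrier recursion from site n - K, starting at 0 or at an independent
    variable of law nu; the latter has law nu at every site.  In case (b) the
    recursion is affine and increasing, so the iterates from 0 are dominated by a
    variable of law nu and converge to a finite minimal carrier, whose law is nu.
    In case (c) the even and odd iterates from 0 converge to limits L <= H which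
    bracket every carrier; the ratios L_n / H_n are stationary and nondecreasing in n,
    hence a.s. constant, which forces L = H.  The carrier is then unique.

    In case (b) carriers are not unique, but if m < U are two carriers then the
    configuration transported by U has no carrier U', because
    (U^2 U' + m) / (U - m) would increase by a fixed amount at each site.  So a
    family is unique, forwards in time and, by reflection, backwards.  It exists
    a.s. because the invariance just proved makes every iterate of the dynamics and
    of its reflection admissible. *)

Set Implicit Arguments.
Unset Strict Implicit.
Unset Printing Implicit Defensive.

Import Order.TTheory GRing.Theory Num.Theory.
Import numFieldNormedType.Exports.
Local Open Scope classical_set_scope.
Local Open Scope ring_scope.

(** * Laws of i.i.d. configurations *)

Lemma pushforward_restr_measure d d' (T1 : measurableType d) (T2 : measurableType d')
  (R : realType) (m : {measure set T1 -> \bar R}) (f : T1 -> T2) (D : set T1) :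
  measurable_fun setT f -> measurable D ->
  exists m' : {measure set T2 -> \bar R},
    forall A, m' A = m (f @^-1` A `&` D).
Proof.
by move=> mf mD; unshelve eexists; first exact: (pushforward (mrestr m mD) f).
Qed.

Lemma measurable_preimage d d' (T1 : measurableType d) (T2 : measurableType d')
  (f : T1 -> T2) (A : set T2) :
  measurable_fun setT f -> measurable A -> measurable (f @^-1` A).
Proof. by move=> mf mA; rewrite -[_ @^-1` _]setTI; exact: mf. Qed.

Section config.
Variable R : realType.
Implicit Types (x : Config R) (s : seq int) (A : int -> set R).

Lemma measurable_coord (n : int) : measurable_fun setT (fun x : Config R => x n).
Proof.
move=> _ B mB; rewrite setTI; apply: sub_sigma_algebra.
by exists n, B.
Qed.

Lemma measurable_to_config d (T : measurableType d) (f : T -> Config R) :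
  (forall n, measurable_fun setT (fun w => f w n)) -> measurable_fun setT f.
Proof.
move=> mf; apply: (@measurability _ _ _ _ _ f (@coord_gen R)) => //.
move=> _ [_ [n [B [mB ->]]] <-].
exact: (mf n measurableT B mB).
Qed.

Definition box s A : set (Config R) := [set x | forall j, j \in s -> A j (x j)].

Lemma measurable_box s A :
  (forall j, j \in s -> measurable (A j)) -> measurable (box s A).
Proof.
elim: s => [|i s IH] mA.
  rewrite (_ : box _ _ = setT); first exact: measurableT.
  by apply/seteqP; split.
rewrite (_ : box _ _ = (fun x : Config R => x i) @^-1` A i `&` box s A).
  apply: measurableI.
    by apply: measurable_preimage; [exact: measurable_coord|apply: mA; rewrite mem_head].
  by apply: IH => j js; apply: mA; rewrite inE js orbT.
apply/seteqP; split=> [x Ax|x [Ai As] j].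
  by split=> [|j js]; apply: Ax; rewrite inE ?eqxx ?js ?orbT.
by rewrite inE => /predU1P[->//|/As].
Qed.

Lemma box_setI s t A B :
  box s A `&` box t B =
  box (s ++ t) (fun j => (if j \in s then A j else setT) `&`
                         (if j \in t then B j else setT)).
Proof.
apply/seteqP; split=> [x [Ax Bx] j _|x AB].
  by split; case: ifPn => // ?; [exact: Ax|exact: Bx].
split=> j jst; have := AB j; rewrite mem_cat jst ?orbT => /(_ isT) [];
  by rewrite ?jst.
Qed.

Lemma box_undup s A : box (undup s) A = box s A.
Proof.
by apply/seteqP; split=> x Ax j js; apply: Ax; move: js; rewrite mem_undup.
Qed.

(** Boxes over finite lists form a pi-system that generates the product sigma-algebra. [box_undup]
    reduces the check to duplicate-free lists, on which an i.i.d. law is a plain product. *)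
Lemma config_measure_unique (m1 m2 : {measure set (Config R) -> \bar R}) :
  (m1 setT < +oo)%E ->
  (forall s A, uniq s -> (forall j, measurable (A j)) -> m1 (box s A) = m2 (box s A)) ->
  forall E, measurable E -> m1 E = m2 E.
Proof.
move=> m1oo m12.
pose G : set (set (Config R)) :=
  [set B | exists s A, (forall j, measurable (A j)) /\ B = box s A].
have mG : G `<=` measurable.
  by move=> _ [s [A [mA ->]]]; exact: measurable_box.
have GT : G setT.
  exists [::], (fun=> setT); split=> [j|]; first exact: measurableT.
  by apply/seteqP; split.
move=> E mE; apply: (measure_unique G (fun=> setT)) => //.
- apply/seteqP; split=> [B|].
    apply: smallest_sub; first exact: smallest_sigma_algebra.
    move=> _ [n [A [mA ->]]]; apply: sub_sigma_algebra.
    exists [:: n], (fun=> A); split => //.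
    by apply/seteqP; split=> [x Ax j /[!inE] /eqP -> //|x /(_ n) /[!inE]]; apply.
  apply: smallest_sub; [exact: sigma_algebra_measurable|exact: mG].
- move=> _ _ [s [A [mA ->]]] [t [B [mB ->]]]; rewrite box_setI.
  exists (s ++ t), (fun j => (if j \in s then A j else setT) `&`
                         (if j \in t then B j else setT)); split=> // j.
  by apply: measurableI; case: ifP.
- by apply/seteqP; split=> // x _; exists 0%N.
- by move=> _ [s [A [mA ->]]]; rewrite -box_undup m12// undup_uniq.
Qed.

Definition config_reindex (sg : int -> int) x : Config R := fun n => x (sg n).

Lemma measurable_config_reindex sg : measurable_fun setT (config_reindex sg).
Proof. by apply: measurable_to_config => n; exact: measurable_coord. Qed.

Section iid.
Variables (mu : probability R R) (P : probability (Config R) R).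
Hypothesis Pmu : iid_law P mu.

Lemma iid_box s A : uniq s -> (forall j, measurable (A j)) ->
  P (box s A) = (\prod_(j <- s) mu (A j))%E.
Proof.
move=> us mA.
have := @Pmu (size s) (fun i => tnth (in_tuple s) i) (fun i => A (tnth (in_tuple s) i)).
rewrite -(big_tnth _ _ s xpredT (fun j => mu (A j))) => <- //.
- congr (P _); apply/seteqP; split=> x Ax.
    by move=> i; apply: Ax; rewrite mem_tnth.
  by move=> j /(tnthP (in_tuple s))[i ->]; exact: Ax.
- by apply/tuple_uniqP.
Qed.

Lemma iid_coord n (A : set R) : measurable A -> P [set x | A (x n)] = mu A.
Proof.
move=> mA; have := @iid_box [:: n] (fun=> A) isT (fun=> mA).
rewrite big_seq1 => <-; congr (P _).
by apply/seteqP; split=> [x Ax j /[!inE] /eqP -> //|x /(_ n) /[!inE]]; apply.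
Qed.

Lemma iid_reindex (sg : int -> int) : injective sg -> forall E, measurable E ->
  P (config_reindex sg @^-1` E) = P E.
Proof.
move=> sgi E mE.
have [m' m'E] := pushforward_restr_measure P (measurable_config_reindex sg) measurableT.
have -> : P (config_reindex sg @^-1` E) = m' E by rewrite m'E setIT.
apply: config_measure_unique => //.
  by rewrite m'E preimage_setT setTI (le_lt_trans (probability_le1 _ _)) ?ltry.
move=> s A us mA; rewrite m'E setIT [RHS](iid_box us mA).
(* The constraint at site [j] is an intersection over the fibre of [sg], which injectivity makes a
   singleton or empty; no inverse of [sg] has to be chosen. *)
rewrite (_ : _ @^-1` _ = box (map sg s) (fun j => \bigcap_(i in [set i | sg i = j]) A i)).
  rewrite [LHS]iid_box ?map_inj_uniq// ?big_map.
    apply: eq_bigr => i _; congr (mu _); apply/seteqP; split=> [y|y Ay j /sgi -> //].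
    exact.
  move=> j; have [[i <-]|ni] := pselect (exists i, sg i = j).
    rewrite (_ : [set i0 | _] = [set i]) ?bigcap_set1//.
    by apply/seteqP; split=> [k /sgi //|k -> //].
  rewrite (_ : [set i0 | _] = set0) ?bigcap_set0//.
  by apply/seteqP; split=> // i ij; case: ni; exists i.
apply/seteqP; split=> [x Ax _ /mapP[j js ->] i /sgi -> |x Ax j js]; first exact: Ax.
by apply: (Ax (sg j)); rewrite ?map_f.
Qed.

(** Freezing the coordinates outside [I] at 1 leaves [D] unchanged. After freezing, both sides are
    finite measures in [D], so it is enough to compare them on boxes. *)
Lemma iid_indep (I : pred int) (D : set (Config R)) s A :
  measurable D -> (forall x y, (forall j, I j -> x j = y j) -> D x -> D y) ->
  uniq s -> (forall j, j \in s -> ~~ I j) -> (forall j, measurable (A j)) ->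
  P (D `&` box s A) = (P D * P (box s A))%E.
Proof.
move=> mD DI us sI mA.
pose f (x : Config R) : Config R := fun j => if I j then x j else 1.
have mf : measurable_fun setT f.
  apply: measurable_to_config => j; rewrite /f; case: (I j) => //.
  exact: measurable_coord.
have mB : measurable (box s A) by exact: measurable_box.
have [m1 m1E] := pushforward_restr_measure P mf mB.
have [m2 m2E] := pushforward_restr_measure P mf measurableT.
have Dxf x : D x <-> D (f x).
  by split; apply: DI => j Ij; rewrite /f Ij.
have DfE : f @^-1` D = D by apply/seteqP; split=> x; [exact: (Dxf x).2|exact: (Dxf x).1].
have Pfin B : measurable B -> P B \is a fin_num by move=> mB'; exact: fin_num_measure.
have c0 : 0 <= fine (P (box s A)) by exact: fine_ge0.
pose c := NngNum c0.
have -> : P (D `&` box s A) = m1 D by rewrite m1E DfE.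
have cm2E B : mscale c m2 B = (P (f @^-1` B) * P (box s A))%E.
  by rewrite /mscale/= m2E setIT fineK ?Pfin// muleC.
have -> : (P D * P (box s A) = mscale c m2 D)%E by rewrite cm2E DfE.
apply: config_measure_unique => //.
  by rewrite m1E preimage_setT setTI (le_lt_trans (probability_le1 _ _))// ?ltry.
move=> t B ut mB'; rewrite m1E [RHS]cm2E.
have [tB|/existsNP[j /not_implyP[jt /not_implyP[Ij Bj]]]] :=
    pselect (forall j, j \in t -> ~~ I j -> B j 1); last first.
  rewrite (_ : f @^-1` _ = set0) ?set0I ?measure0 ?mul0e//.
  by apply/seteqP; split=> // x /(_ j jt); rewrite /f (negbTE Ij).
rewrite (_ : f @^-1` _ = box ([seq j <- t | I j]) B); last first.
  apply/seteqP; split=> x Bx j.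
    by rewrite mem_filter => /andP[Ij /Bx]; rewrite /f Ij.
  by rewrite /f; case: ifPn => [Ij jt|Ij jt]; [apply: Bx; rewrite mem_filter Ij|exact: tB].
rewrite (_ : _ `&` _ = box (s ++ [seq j <- t | I j]) (fun j => if I j then B j else A j)).
  transitivity (\prod_(j <- [seq j <- t | I j]) mu (B j) * \prod_(j <- s) mu (A j))%E;
    last first.
    by congr (_ * _)%E; [rewrite [RHS]iid_box ?filter_uniq|rewrite [RHS]iid_box].
  rewrite [LHS]iid_box.
  - rewrite big_cat/= muleC; congr (_ * _)%E; rewrite [LHS]big_seq [RHS]big_seq.
      by apply: eq_bigr => j; rewrite mem_filter => /andP[-> _].
    by apply: eq_bigr => j /sI/negbTE ->.
  - rewrite cat_uniq us filter_uniq// andbT; apply/hasPn => j.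
    by rewrite mem_filter => /andP[Ij _]; apply/negP => /sI; rewrite Ij.
  - by move=> j; case: ifP.
apply/seteqP; split=> [x [Bx Ax] j|x AB].
  rewrite mem_cat => /orP[js|jt]; first by rewrite (negbTE (sI _ js)); exact: Ax.
  by have := jt; rewrite mem_filter => /andP[-> _]; exact: Bx.
split=> j.
  move=> jt; have := AB j; rewrite mem_cat jt orbT => /(_ isT).
  by move: jt; rewrite mem_filter => /andP[-> _].
by move=> js; have := AB j; rewrite mem_cat js (negbTE (sI _ js)) => /(_ isT).
Qed.

End iid.
End config.

(** * Multiplicative Haar measure *)

Section density_measure.
Context d (T : measurableType d) (R : realType).
Variables (m : {measure set T -> \bar R}) (g : T -> R).
Hypothesis mg : measurable_fun setT g.
Hypothesis g0 : forall x, 0 <= g x.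

Definition density_measure of measurable_fun setT g & (forall x, 0 <= g x) :
  set T -> \bar R := fun A => (\int[m]_(x in A) (g x)%:E)%E.

Local Notation dg := (density_measure mg g0).

Let dg0 : dg set0 = 0%E. Proof. by rewrite /dg integral_set0. Qed.

Let dg_ge0 A : (0 <= dg A)%E.
Proof. by apply: integral_ge0 => x _; rewrite lee_fin. Qed.

Let dg_sigma_additive : semi_sigma_additive dg.
Proof.
move=> /= A mA tA mUA.
rewrite /density_measure ge0_integral_bigcup//=; last 2 first.
- by apply: measurable_funS (subsetT _) _ => //; exact/measurable_EFinP.
- by move=> x _; rewrite lee_fin.
apply: is_cvg_ereal_nneg_natsum_cond => n _ _.
by apply: integral_ge0 => /= x ?; rewrite lee_fin.
Qed.

HB.instance Definition _ := isMeasure.Build _ _ _ dg dg0 dg_ge0 dg_sigma_additive.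

End density_measure.

Section haar.
Variable R : realType.
Local Notation leb := (@lebesgue_measure R).

(** By uniqueness of Lebesgue measure: [k] times its image under dilation by [k] gives half-open
    intervals their length. *)
Lemma lebesgue_integral_scale (k : R) (f : R -> \bar R) : 0 < k ->
  measurable_fun [set: R] f -> (forall x, 0 <= f x)%E ->
  (\int[leb]_x (k%:E * f (k * x)%R) = \int[leb]_x f x)%E.
Proof.
move=> k0 mf f0.
have mk : measurable_fun setT (fun x : measurableTypeR R => k * x : measurableTypeR R).
  exact: measurable_funM.
have [m' m'E] := pushforward_restr_measure leb mk measurableT.
have mfk : measurable_fun [set: R] (fun x => f (k * x)%R).
  by apply: (measurableT_comp mf); exact: measurable_funM.
have kge0 : 0 <= k by exact: ltW.
pose K := NngNum kge0.
have leb_m' A : measurable A -> leb A = mscale K m' A.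
  apply: lebesgue_measure_unique => _ [[a b]] _ <-.
  transitivity (k%:E * leb (( *%R k) @^-1` `]a, b]))%E; last first.
    by rewrite -[X in leb X]setIT -m'E.
  have -> : ( *%R k) @^-1` `]a, b]%classic = `]a / k, b / k]%classic.
    apply/seteqP; split=> x /=; rewrite !in_itv/= ltr_pdivrMr// ler_pdivlMr//.
      by rewrite ![x * k]mulrC.
    by rewrite ![x * k]mulrC.
  rewrite !lebesgue_measure_itv/= !lte_fin ltr_pM2r ?invr_gt0//.
  case: ifPn => _; last by rewrite mule0.
  by rewrite -!EFinB -EFinM -mulrBl mulrC divfK// gt_eqF.
transitivity (\int[mscale K m']_x f x)%E; last first.
  by apply: eq_measure_integral => A mA _; exact/esym/leb_m'.
rewrite ge0_integral_mscale//= ge0_integralZl//.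
congr (_ * _)%E.
transitivity (\int[pushforward leb (fun x : measurableTypeR R => (k * x)%R : measurableTypeR R)]_x f x)%E.
  by rewrite ge0_integral_pushforward.
by apply: eq_measure_integral => A mA _; rewrite [RHS]m'E setIT.
Qed.

(** The density of the Haar measure ds/s of the multiplicative group, extended by 0 so that
    integrals can run over the whole line. *)
Definition hinv (s : R) : R := if 0 < s then s^-1 else 0.

Lemma hinv_ge0 s : 0 <= hinv s.
Proof. by rewrite /hinv; case: ifPn => // s0; rewrite invr_ge0 ltW. Qed.

Lemma measurable_invr d (T : measurableType d) (D : set T) (f : T -> R) :
  measurable_fun D f -> measurable_fun D (fun x => (f x)^-1).
Proof.
(* The power of exponent -1 is the inverse on positive reals, and oddness covers negative ones; at 0
   both sides are 0 by convention. *)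
have -> : (fun x => (f x)^-1) =
    (fun y : R => if 0 < y then y `^ (-1) else - ((- y) `^ (-1))) \o f.
  apply/funext => x /=; case: ltP => [x0|x0]; first by rewrite powR_inv1 ?ltW.
  by rewrite powR_inv1 ?oppr_ge0// invrN opprK.
move=> mf; apply: measurableT_comp => //.
apply: measurable_fun_ifT => //; first exact: measurable_fun_ltr.
apply: measurable_funN.
by apply: (measurableT_comp (measurable_powR _)); exact: measurable_funN.
Qed.

Lemma measurable_hinv : measurable_fun [set: R] hinv.
Proof.
apply: measurable_fun_ifT => //; first exact: measurable_fun_ltr.
exact: measurable_invr.
Qed.

(* [lebesgue_measure] lives on [measurableTypeR R], whose display differs from
   the one of the canonical measurable structure of [R]. *)
Definition lebR : set R -> \bar R :=
  pushforward leb (idfun : measurableTypeR R -> R).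

Let measurable_id_lebR : measurable_fun setT (idfun : measurableTypeR R -> R).
Proof. by move=> _ Y mY; rewrite setTI. Qed.

HB.instance Definition _ := Measure.copy lebR
  (measure_function_pushforward__canonical__measure_function_Measure leb measurable_id_lebR).

Let lebR_sigma_finite : sigma_finite setT lebR.
Proof. exact: (sigma_finiteT leb). Qed.

HB.instance Definition _ := Measure_isSigmaFinite.Build _ _ _ lebR lebR_sigma_finite.

Lemma integral_lebR (D : set R) (f : R -> \bar R) : measurable D ->
  measurable_fun D f -> (forall x, D x -> 0 <= f x)%E ->
  (\int[leb]_(x in D) f x = \int[lebR]_(x in D) f x)%E.
Proof.
by move=> mD mf f0; rewrite ge0_integral_pushforward// => y /[!inE]; exact: f0.
Qed.

Lemma haar_scale (k : R) (f : R -> \bar R) : 0 < k ->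
  measurable_fun setT f -> (forall x, 0 <= f x)%E ->
  (\int[lebR]_x (f (k * x)%R * (hinv x)%:E) = \int[lebR]_x (f x * (hinv x)%:E))%E.
Proof.
move=> k0 mf f0.
have mk : measurable_fun [set: R] (fun x => k * x) by exact: measurable_funM.
have mh : measurable_fun [set: R] (EFin \o hinv).
  by apply/measurable_EFinP; exact: measurable_hinv.
have fh0 x : (0 <= f x * (hinv x)%:E)%E by rewrite mule_ge0// lee_fin hinv_ge0.
rewrite -!integral_lebR//.
- rewrite -[RHS](lebesgue_integral_scale k0)//; last exact: emeasurable_funM.
  apply: eq_integral => x _; rewrite muleCA -EFinM; congr (_ * _%:E)%E.
  rewrite /hinv pmulr_rgt0//; case: ifP => // x0; rewrite ?mulr0//.
  by rewrite invfM mulVKf// gt_eqF.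
- exact: emeasurable_funM.
- by apply: emeasurable_funM => //; exact: (measurableT_comp mf mk).
- by move=> x _; rewrite mule_ge0// lee_fin hinv_ge0.
Qed.

End haar.

(** * Haar measure on pairs and its invariance under [F_dK] *)

Section haar2.
Variable R : realType.
Local Notation lebR := (@lebR R).
Local Notation hinv := (@hinv R).
Implicit Types (phi : R * R -> \bar R).

Definition haar2 phi : \bar R :=
  (\int[lebR]_x \int[lebR]_u (phi (x, u) * (hinv u * hinv x)%:E))%E.

Lemma eq_haar2 phi phi' :
  (forall x u, 0 < x -> 0 < u -> phi (x, u) = phi' (x, u)) ->
  haar2 phi = haar2 phi'.
Proof.
move=> e; apply: eq_integral => x _; apply: eq_integral => u _.
rewrite /hinv; case: ifPn => u0; last by rewrite mul0r !mule0.
by case: ifPn => x0; [rewrite e|rewrite mulr0 !mule0].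
Qed.

Lemma measurable_haar2_integrand phi : measurable_fun setT phi ->
  measurable_fun setT (fun p : R * R => phi p * (hinv p.2 * hinv p.1)%:E)%E.
Proof.
move=> mphi; apply: emeasurable_funM => //; apply/measurable_EFinP.
apply: measurable_funM.
  exact: (measurableT_comp (@measurable_hinv R) measurable_snd).
exact: (measurableT_comp (@measurable_hinv R) measurable_fst).
Qed.

Lemma haar2_swap phi : measurable_fun setT phi -> (forall p, 0 <= phi p)%E ->
  haar2 phi = haar2 (phi \o (fun p => (p.2, p.1))).
Proof.
move=> mphi phi0; rewrite /haar2.
rewrite (@fubini_tonelli _ _ _ _ _ lebR lebR (fun p => (phi p * (hinv p.2 * hinv p.1)%:E)%E)).
- by apply: eq_integral => x _; apply: eq_integral => u _; rewrite /= (mulrC (hinv x)).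
- exact: measurable_haar2_integrand.
- by move=> p; rewrite mule_ge0// lee_fin mulr_ge0// hinv_ge0.
Qed.

(** The factor is constant on each fibre over the first coordinate, so one-dimensional Haar
    invariance applies to the inner integral; a nonpositive [x] carries weight 0. *)
Lemma haar2_scale (c : R -> R) phi : (forall x, 0 < x -> 0 < c x) ->
  measurable_fun setT phi -> (forall p, 0 <= phi p)%E ->
  haar2 (fun p => phi (p.1, c p.1 * p.2)) = haar2 phi.
Proof.
move=> c0 mphi phi0; apply: eq_integral => x _ /=.
have mphix : measurable_fun setT (fun u => phi (x, u)).
  exact: (measurableT_comp mphi (pair1_measurable x)).
have [x0|x0] := ltP 0 x; last first.
  by under eq_integral do rewrite {2}/hinv ltNge x0/= mulr0 mule0;
     under [in RHS]eq_integral do rewrite {2}/hinv ltNge x0/= mulr0 mule0.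
under eq_integral do rewrite EFinM muleA.
under [in RHS]eq_integral do rewrite EFinM muleA.
have mh : measurable_fun [set: R] (EFin \o hinv).
  by apply/measurable_EFinP; exact: measurable_hinv.
rewrite !ge0_integralZr//.
- by rewrite (haar_scale (c0 _ x0) mphix).
- exact: emeasurable_funM.
- by move=> u _; rewrite mule_ge0// lee_fin hinv_ge0.
- by rewrite lee_fin hinv_ge0.
- apply: emeasurable_funM => //; apply: (measurableT_comp mphix).
  exact: measurable_funM.
- by move=> u _; rewrite mule_ge0// lee_fin hinv_ge0.
- by rewrite lee_fin hinv_ge0.
Qed.

Variables a b : R.
Hypotheses (a0 : 0 <= a) (b0 : 0 <= b).

Let k (s : R) := (1 + a * s) / (1 + b * s).

Let aff_gt0 c (s : R) : 0 <= c -> 0 < s -> 0 < 1 + c * s.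
Proof. by move=> c0 s0; rewrite ltr_wpDr// mulr_ge0// ltW. Qed.

Let k_gt0 s : 0 < s -> 0 < k s.
Proof. by move=> s0; rewrite divr_gt0// aff_gt0. Qed.

Let measurable_k : measurable_fun [set: R] k.
Proof.
by apply: measurable_funM; [|apply: measurable_invr];
  apply: measurable_funD => //; exact: measurable_funM.
Qed.

(* With s = xu, the map F is (x, u) |-> (s / v, v) where v = x k(s); hence it is
   a composition of the scalings u |-> xu, x |-> x k(s) and s |-> s / v, each of
   which preserves the Haar measure of the multiplicative group. *)
Lemma haar2_F_dK phi : measurable_fun setT phi -> (forall p, 0 <= phi p)%E ->
  haar2 (fun p => phi (F_dK a b p.1 p.2)) = haar2 phi.
Proof.
move=> mphi phi0.
(* [phi1], [phi2] and [phi3] are [phi] read in the coordinates (x, s), (s, v) and (v, s / v). Since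
   [haar2_scale] rescales the second coordinate only, a swap comes between successive changes. *)
pose phi1 := fun p : R * R => phi (p.2 / (p.1 * k p.2), p.1 * k p.2).
pose phi2 := fun p : R * R => phi (p.1 / p.2, p.2).
pose phi3 := fun p : R * R => phi (p.2, p.1).
have m1 : measurable_fun setT (fst : R * R -> R) by exact: measurable_fst.
have m2 : measurable_fun setT (snd : R * R -> R) by exact: measurable_snd.
have mk2 : measurable_fun setT (fun p : R * R => k p.2).
  exact: measurableT_comp.
have mphi1 : measurable_fun setT phi1.
  apply: (measurableT_comp mphi); apply: measurable_fun_pair => /=.
    by apply: measurable_funM => //; apply: measurable_invr; exact: measurable_funM.
  exact: measurable_funM.
have mphi2 : measurable_fun setT phi2.
  apply: (measurableT_comp mphi); apply: measurable_fun_pair => //=.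
  by apply: measurable_funM => //; exact: measurable_invr.
have mphi3 : measurable_fun setT phi3.
  by apply: (measurableT_comp mphi); exact: measurable_fun_pair.
transitivity (haar2 (fun p => phi1 (p.1, p.1 * p.2))).
  apply: eq_haar2 => x u x0 u0; rewrite /phi1 /=.
  suff -> : F_dK a b x u = (x * u / (x * k (x * u)), x * k (x * u)) by [].
  have xu0 : 0 < x * u by exact: mulr_gt0.
  have /gt_eqF an := aff_gt0 a0 xu0; have /gt_eqF bn := aff_gt0 b0 xu0.
  rewrite /F_dK /k -!mulrA; congr pair; field;
    by rewrite ?an ?bn ?gt_eqF.
transitivity (haar2 phi1); first by apply: (@haar2_scale id phi1) => // p; exact: phi0.
transitivity (haar2 (fun p => phi2 (p.1, k p.1 * p.2))).
  rewrite (haar2_swap mphi1 (fun p => phi0 _)); apply: eq_haar2 => s x s0 x0.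
  by rewrite /phi1 /phi2 /= (mulrC x).
transitivity (haar2 phi2); first by apply: haar2_scale => // p; exact: phi0.
transitivity (haar2 (fun p => phi3 (p.1, p.1^-1 * p.2))).
  rewrite (haar2_swap mphi2 (fun p => phi0 _)); apply: eq_haar2 => v s v0 s0.
  by rewrite /phi2 /phi3 /= (mulrC s).
transitivity (haar2 phi3).
  by apply: haar2_scale => // [v v0|p]; [rewrite invr_gt0|exact: phi0].
by rewrite (haar2_swap mphi3 (fun p => phi0 _)); apply: eq_haar2.
Qed.

End haar2.

(** * Product laws with densities *)

Section pdf.
Variable R : realType.
Local Notation lebR := (@lebR R).

Definition has_pdf (mu : set R -> \bar R) (g : R -> R) :=
  [/\ measurable_fun setT g, (forall x, 0 <= g x), (forall x, x <= 0 -> g x = 0) &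
   forall A, measurable A -> mu A = (\int[lebR]_(x in A) (g x)%:E)%E].

Definition preserves_product (a b : R) (mu nu : probability R R) :=
  forall A B : set R, measurable A -> measurable B ->
  (mu \x nu)%E [set p | A (F_dK a b p.1 p.2).1 /\ B (F_dK a b p.1 p.2).2] =
  (mu A * nu B)%E.

Lemma measurable_F_dK (a b : R) :
  measurable_fun setT (fun p : R * R => F_dK a b p.1 p.2).
Proof.
have m1 : measurable_fun setT (fst : R * R -> R) by exact: measurable_fst.
have m2 : measurable_fun setT (snd : R * R -> R) by exact: measurable_snd.
have aff c : measurable_fun setT (fun p : R * R => 1 + c * p.1 * p.2).
  by apply: measurable_funD => //; do 2 apply: measurable_funM => //.
by apply: measurable_fun_pair => /=; (apply: measurable_funM;
  [apply: measurable_funM|apply: measurable_invr]).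
Qed.

Variables (mu nu : probability R R) (g h : R -> R).
Hypotheses (mug : has_pdf mu g) (nuh : has_pdf nu h).

Let mg : measurable_fun setT g. Proof. by case: mug. Qed.
Let mh : measurable_fun setT h. Proof. by case: nuh. Qed.
Let g0 x : 0 <= g x. Proof. by case: mug. Qed.
Let h0 x : 0 <= h x. Proof. by case: nuh. Qed.

Let gh (p : R * R) := g p.1 * h p.2.
Let mgh : measurable_fun setT gh.
Proof.
apply: measurable_funM.
  exact: (measurableT_comp mg measurable_fst).
exact: (measurableT_comp mh measurable_snd).
Qed.
Let gh0 p : 0 <= gh p. Proof. exact: mulr_ge0. Qed.

Let densE (f : R -> R) (A : set R) : measurable_fun setT f -> (forall x, 0 <= f x) ->
  measurable A ->
  (\int[lebR]_(x in A) (f x)%:E = \int[lebR]_x (f x * \1_A x)%:E)%E.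
Proof.
move=> mf f0 mA; rewrite integral_mkcond; apply: eq_integral => x _.
by rewrite restrict_EFin patch_indic.
Qed.

(** The factors [p.1] and [p.2] cancel the Haar weights; at nonpositive arguments both integrands
    vanish because [g] or [h] does. *)
Lemma product_pdf S : measurable S ->
  (mu \x nu)%E S = haar2 (fun p => (g p.1 * p.1 * (h p.2 * p.2) * \1_S p)%:E).
Proof.
have ghS S' : measurable S' ->
    (density_measure (lebR \x lebR)%E mgh gh0 S' =
     \int[lebR]_x \int[lebR]_u (gh (x, u) * \1_S' (x, u))%:E)%E.
  move=> mS'; rewrite /density_measure integral_mkcond.
  under eq_integral do rewrite restrict_EFin patch_indic.
  rewrite fubini_tonelli1//.
    by apply/measurable_EFinP/measurable_funM => //; exact: measurable_indic.
  by move=> p; rewrite lee_fin mulr_ge0.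
move=> mS.
rewrite (@product_measure_unique _ _ _ _ _ mu nu
  (density_measure (lebR \x lebR)%E mgh gh0)) => [|A B mA mB|//]; last first.
  have [[_ _ _ muE] [_ _ _ nuE]] := (mug, nuh).
  have iX x u : \1_(A `*` B) (x, u) = \1_A x * \1_B u :> R.
    rewrite !indicE -natrM mulnb; congr (nat_of_bool _)%:R.
    by apply/idP/andP => [/[!inE]-[? ?]|[/[!inE]]]; rewrite ?inE.
  rewrite [LHS]ghS; last exact: measurableX.
  transitivity (\int[lebR]_x (g x * \1_A x)%:E * \int[lebR]_x (h x * \1_B x)%:E)%E;
    last by rewrite -!densE//; congr (_ * _)%E; apply/esym; [exact: muE|exact: nuE].
  transitivity (\int[lebR]_x ((g x * \1_A x)%:E * \int[lebR]_u (h u * \1_B u)%:E))%E.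
    apply: eq_integral => x _; rewrite -ge0_integralZl//.
    - by apply: eq_integral => u _; rewrite -EFinM /gh/= iX mulrACA.
    - by apply/measurable_EFinP/measurable_funM.
    - by move=> u _; rewrite lee_fin mulr_ge0.
    - by rewrite lee_fin mulr_ge0.
  rewrite ge0_integralZr//.
  - by apply/measurable_EFinP/measurable_funM.
  - by move=> u _; rewrite lee_fin mulr_ge0.
  - by apply: integral_ge0 => u _; rewrite lee_fin mulr_ge0.
rewrite [LHS](ghS _ mS); apply: eq_integral => x _; apply: eq_integral => u _.
rewrite -EFinM; congr (_%:E); rewrite /gh /hinv/=.
case: ifPn => [u0|]; last first.
  by rewrite -leNgt => u0; have [_ _ -> //] := nuh; rewrite !(mulr0, mul0r).
case: ifPn => [x0|]; last first.
  by rewrite -leNgt => x0; have [_ _ -> //] := mug; rewrite !(mulr0, mul0r).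
by field; rewrite !gt_eqF.
Qed.

(** Relative to Haar measure the density is g(x) h(u) times xu. Since [F_dK] preserves xu and the
    Haar measure, only the invariance of g(x) h(u) is left to assume. *)
Lemma pdf_preserves_product (a b : R) : 0 <= a -> 0 <= b ->
  (forall x u, 0 < x -> 0 < u ->
    g x * h u = g (F_dK a b x u).1 * h (F_dK a b x u).2) ->
  preserves_product a b mu nu.
Proof.
move=> a0 b0 ghF A B mA mB.
have mAB : measurable (A `*` B) by exact: measurableX.
have mFAB := measurable_preimage (measurable_F_dK a b) mAB.
transitivity ((mu \x nu)%E (A `*` B)); last exact: product_measure1E.
rewrite [LHS](product_pdf mFAB) [RHS](product_pdf mAB).
rewrite -[RHS](haar2_F_dK a0 b0); last 2 first.
- apply/measurable_EFinP/measurable_funM; last exact: measurable_indic.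
  apply: measurable_funM; apply: measurable_funM.
  + exact: (measurableT_comp mg measurable_fst).
  + exact: measurable_fst.
  + exact: (measurableT_comp mh measurable_snd).
  + exact: measurable_snd.
- move=> p; rewrite lee_fin; apply: mulr_ge0 => //.
  have [p10|p10] := leP p.1 0.
    by have [_ _ -> //] := mug; rewrite !mul0r.
  have [p20|p20] := leP p.2 0.
    by have [_ _ -> //] := nuh; rewrite !(mulr0, mul0r).
  by rewrite !mulr_ge0// ltW.
apply: eq_haar2 => x u x0 u0 /=; congr (_%:E).
congr (_ * _).
rewrite [LHS]mulrACA ghF// [RHS]mulrACA; congr (_ * _).
have xu0 : 0 < x * u by exact: mulr_gt0.
have aff c : 0 <= c -> (1 + c * x * u == 0) = false.
  by move=> c0; rewrite gt_eqF// ltr_wpDr// !mulr_ge0// ltW.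
by rewrite /F_dK/=; field; rewrite !aff.
Qed.

End pdf.

(** * GIG and IG laws *)

Section gig.
Variable R : realType.
Local Notation lebR := (@lebR R).

(** The cut-off is on the argument, not on the value: [f] is kept on the open half-line and set to 0
    elsewhere. *)
Definition pos_part_fun (f : R -> R) (x : R) := if 0 < x then f x else 0.

Lemma normalized_pdf (mu0 : probability R R) (f : R -> R) :
  measurable_fun setT f -> (forall x, 0 < x -> 0 < f x) ->
  (\int[lebR]_x (pos_part_fun f x)%:E < +oo)%E ->
  exists (nu : probability R R) (k : R), 0 < k /\
    has_pdf nu (fun x => k * pos_part_fun f x).
Proof.
move=> mf f0 foo; set f' := pos_part_fun f in foo *.
have mf' : measurable_fun setT f'.
  by apply: measurable_fun_ifT => //; exact: measurable_fun_ltr.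
have f'0 x : 0 <= f' x by rewrite /f' /pos_part_fun; case: ifPn => // /f0/ltW.
pose I := (\int[lebR]_x (f' x)%:E)%E.
have I0 : (0 <= I)%E by apply: integral_ge0 => x _; rewrite lee_fin.
(* A zero integral would make [f'] vanish almost everywhere, but it is positive on the unit
   interval, which has measure 1. *)
have In0 : I != 0%E.
  apply/eqP => I_0.
  have : ae_eq lebR setT (EFin \o f') (cst 0%E).
    apply/(ae_eq_integral_abs lebR measurableT).
      exact/measurable_EFinP.
    by rewrite -[RHS]I_0; apply: eq_integral => x _; rewrite gee0_abs ?lee_fin.
  move=> [N [mN N0 sN]].
  have : (lebR `]0%R, 1%R[%classic <= lebR N)%E.
    apply: le_measure; rewrite ?inE// => x /=; rewrite in_itv/= => /andP[x0 _].
    apply: sN => /= /(_ Logic.I) /eqP.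
    by rewrite eqe /f' /pos_part_fun x0 gt_eqF// f0.
  rewrite N0 (_ : lebR _ = 1%E) ?lee_fin ?ler10//.
  by rewrite /lebR /pushforward preimage_id lebesgue_measure_itv/= lte_fin ltr01 oppr0 adde0.
have Ifin : I \is a fin_num by rewrite ge0_fin_numE.
have fI0 : 0 < fine I by rewrite fine_gt0// lt0e In0 I0.
exists (mnormalize (density_measure lebR mf' f'0) mu0), (fine I)^-1.
split; first by rewrite invr_gt0.
split.
- exact: measurable_funM.
- by move=> x; rewrite mulr_ge0// invr_ge0 ltW.
- by move=> x x0; rewrite /f' /pos_part_fun ltNge x0 mulr0.
- move=> A mA; rewrite /= /mnormalize; cbv zeta; rewrite ifF; last first.
    apply/negbTE; rewrite negb_or; apply/andP; split; first exact: In0.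
    by rewrite -ltey; exact: foo.
  transitivity ((\int[lebR]_(x in A) (f' x)%:E) * (fine I)^-1%:E)%E; first by [].
  under [RHS]eq_integral do rewrite EFinM.
  rewrite muleC ge0_integralZl//.
  - by apply: measurable_funS (subsetT _) _ => //; exact/measurable_EFinP.
  - by move=> x _; rewrite lee_fin.
  - by rewrite lee_fin invr_ge0 ltW.
Qed.

Lemma measurable_powR_expR lam (e : R -> R) : measurable_fun setT e ->
  measurable_fun setT (fun x : R => x `^ (- lam - 1) * expR (e x)).
Proof.
move=> me; apply: measurable_funM; first exact: measurable_powR.
exact: (measurableT_comp (@measurable_expR R)).
Qed.

Lemma measurable_GIG_density (lam c1 c2 : R) :
  measurable_fun setT (GIG_density lam c1 c2).
Proof.
apply: measurable_powR_expR; apply: measurable_funB.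
  by apply: measurable_funN; exact: measurable_funM.
by apply: measurable_funM => //; exact: measurable_invr.
Qed.

Lemma measurable_IG_density (lam c : R) : measurable_fun setT (IG_density lam c).
Proof.
apply: measurable_powR_expR; apply: measurable_funN.
by apply: measurable_funM => //; exact: measurable_invr.
Qed.

Lemma GIG_density_gt0 (lam c1 c2 x : R) : 0 < x -> 0 < GIG_density lam c1 c2 x.
Proof. by move=> x0; rewrite mulr_gt0 ?powR_gt0 ?expR_gt0. Qed.

Lemma IG_density_gt0 (lam c x : R) : 0 < x -> 0 < IG_density lam c x.
Proof. by move=> x0; rewrite mulr_gt0 ?powR_gt0 ?expR_gt0. Qed.

Lemma density_prop_pdf (mu : probability R R) (f : R -> R) :
  measurable_fun setT f -> (forall x, 0 < x -> 0 < f x) ->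
  has_density_prop mu f ->
  exists k : R, 0 < k /\ has_pdf mu (fun x => k * pos_part_fun f x).
Proof.
move=> mf f0 [k [k0 muE]]; exists k; split => //.
have mf' : measurable_fun setT (pos_part_fun f).
  by apply: measurable_fun_ifT => //; exact: measurable_fun_ltr.
have f'0 x : 0 <= pos_part_fun f x.
  by rewrite /pos_part_fun; case: ifPn => // /f0/ltW.
split.
- exact: measurable_funM.
- by move=> x; rewrite mulr_ge0// ltW.
- by move=> x x0; rewrite /pos_part_fun ltNge x0 mulr0.
- move=> A mA; rewrite muE//.
  under [RHS]eq_integral do rewrite EFinM.
  rewrite ge0_integralZl//; last 3 first.
  + by apply: measurable_funS (subsetT _) _ => //; exact/measurable_EFinP.
  + by move=> x _; rewrite lee_fin.
  + by rewrite lee_fin ltW.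
  congr (_ * _)%E; rewrite -integral_lebR//; last 2 first.
  + by apply: measurable_funS (subsetT _) _ => //; exact/measurable_EFinP.
  + by move=> x _; rewrite lee_fin.
  rewrite integral_mkcondr; apply: eq_integral => x _.
  rewrite /pos_part_fun patchE; have [x0|x0] := ltP 0 x.
    by rewrite ifT// inE.
  by rewrite ifF//; apply/negbTE; rewrite notin_setE /= ltNge x0.
Qed.

Lemma pdf_integral_fin (mu : probability R R) (k : R) (f : R -> R) :
  0 < k -> measurable_fun setT f -> (forall x, 0 <= f x) ->
  has_pdf mu (fun x => k * f x) -> (\int[lebR]_x (f x)%:E < +oo)%E.
Proof.
move=> k0 mf f0 [_ _ _ /(_ setT measurableT)].
under eq_integral do rewrite EFinM.
rewrite ge0_integralZl//; last 3 first.
- exact/measurable_EFinP.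
- by move=> x _; rewrite lee_fin.
- by rewrite lee_fin ltW.
move=> muT; rewrite ltey; apply/eqP => Ioo.
move: muT; rewrite Ioo gt0_muley ?lte_fin// => muT.
by have := probability_le1 mu measurableT; rewrite [X in (X <= _)%E]muT leye_eq.
Qed.

(** By the fundamental theorem of calculus: the antiderivative is x to the power -lam, divided by
    -lam, and it tends to 0 at infinity since lam > 0. *)
Lemma powR_integral_fin (lam : R) : 0 < lam ->
  (\int[lebR]_(x in `[1%R, +oo[) (x `^ (- lam - 1))%:E < +oo)%E.
Proof.
move=> lam0.
rewrite -integral_lebR//; last 2 first.
- by apply: measurable_funS (subsetT _) _ => //; apply/measurable_EFinP; exact: measurable_powR.
- by move=> x _; rewrite lee_fin powR_ge0.
have dF (x : R) : 0 < x ->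
    is_derive x 1 (fun y : R => (- lam^-1) * y `^ (- lam)) (x `^ (- lam - 1)).
  move=> x0; have d := is_derive1_powR (- lam) x0.
  rewrite (_ : (fun y : R => _) = (- lam^-1) \*: ((fun y : R => y `^ (- lam)) : R -> R^o))//.
  apply: is_derive_eq; rewrite /GRing.scale/= mulrA mulrNN mulVf ?mul1r//.
  by rewrite gt_eqF.
rewrite (@ge0_continuous_FTC2y _ _ (fun y : R => (- lam^-1) * y `^ (- lam)) 1 0).
- by rewrite -EFinB ltry.
- by move=> x _; exact: powR_ge0.
- apply: continuous_in_subspaceT => x; rewrite inE/= in_itv/= andbT => x1.
  have x0 : 0 < x by exact: lt_le_trans x1.
  apply: differentiable_continuous; apply/derivable1_diffP.
  by apply: derivable_powR; rewrite in_itv/= x0.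
- rewrite -[X in _ --> X](mulr0 (- lam^-1)); apply: cvgMr.
  apply/cvgrPdist_lt => e e0; near=> x.
  have x0 : 0 < x by near: x; exact: nbhs_pinfty_gt.
  rewrite sub0r normrN ger0_norm ?powR_ge0// powRN invf_plt ?posrE ?powR_gt0//.
  have : (e^-1 `^ lam^-1) < x by near: x; exact: nbhs_pinfty_gt.
  move=> /(gt0_ltr_powR lam0); rewrite -powRrM mulVf ?gt_eqF// powRr1 ?invr_ge0 ?ltW//.
  by apply; rewrite nnegrE ?powR_ge0 ?ltW.
- by move=> x x1; apply: ex_derive; apply: dF; exact: lt_trans x1.
- apply: cvg_at_right_filter.
  have /derivable1_diffP/differentiable_continuous :
    derivable (fun y : R => (- lam^-1) * y `^ (- lam)) 1 1.
    by have d := dF 1 ltr01; exact: ex_derive.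
  exact.
- move=> x; rewrite in_itv/= andbT => x1.
  by rewrite derive1E; apply: derive_val; apply: dF; exact: lt_trans x1.
Unshelve. all: by end_near. Qed.

End gig.

Section gig_pairs.
Variable R : realType.
Local Notation lebR := (@lebR R).

Lemma has_pdf_le0 (nu : set R -> \bar R) g : has_pdf nu g ->
  nu [set x | x <= 0] = 0%E.
Proof.
move=> [mg _ g0 ->]; last by rewrite -set_itvNyc.
by rewrite integral0_eq// => x /g0 ->.
Qed.

(** Below 1 the factor exp(-c1 x) is at least exp(-c1), so IG is at most exp(c1) times GIG. From 1
    on, IG is at most the integrable power [t]. *)
Lemma IG_integral_fin (lam c1 c2 : R) : 0 < lam -> 0 <= c1 -> 0 <= c2 ->
  (\int[lebR]_x (pos_part_fun (GIG_density lam c1 c2) x)%:E < +oo)%E ->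
  (\int[lebR]_x (pos_part_fun (IG_density lam c2) x)%:E < +oo)%E.
Proof.
move=> lam0 c10 c20 GIGoo.
have mG : measurable_fun setT (pos_part_fun (GIG_density lam c1 c2)).
  apply: measurable_fun_ifT => //; first exact: measurable_fun_ltr.
  exact: measurable_GIG_density.
have mI : measurable_fun setT (pos_part_fun (IG_density lam c2)).
  apply: measurable_fun_ifT => //; first exact: measurable_fun_ltr.
  exact: measurable_IG_density.
have G0 x : 0 <= pos_part_fun (GIG_density lam c1 c2) x.
  by rewrite /pos_part_fun; case: ifPn => // x0; rewrite ltW// GIG_density_gt0.
have I0 x : 0 <= pos_part_fun (IG_density lam c2) x.
  by rewrite /pos_part_fun; case: ifPn => // x0; rewrite ltW// IG_density_gt0.
pose t x : R := x `^ (- lam - 1) * \1_(`[1%R, +oo[) x.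
have mt : measurable_fun setT t.
  apply: measurable_funM; first exact: measurable_powR.
  exact: measurable_indic.
have t0 x : 0 <= t x by rewrite mulr_ge0// powR_ge0.
apply: (@le_lt_trans _ _ (\int[lebR]_x
   ((expR c1 * pos_part_fun (GIG_density lam c1 c2) x)%:E + (t x)%:E))%E).
  apply: ge0_le_integral => //.
  - by move=> x _; rewrite lee_fin.
  - exact/measurable_EFinP.
  - by apply: emeasurable_funD; apply/measurable_EFinP => //; exact: measurable_funM.
  move=> x _; rewrite -EFinD lee_fin /pos_part_fun.
  case: ifPn => [x0|_]; last by rewrite mulr0 add0r.
  have [x1|x1] := ltP x 1.
    rewrite ler_wpDr// /IG_density /GIG_density mulrCA ler_pM2l ?powR_gt0//.
    rewrite -expRD ler_expR addrA lerDr subr_ge0.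
    by rewrite ler_piMr// ltW.
  rewrite ler_wpDl//.
    by rewrite mulr_ge0// ?expR_ge0// ltW// GIG_density_gt0.
  rewrite /t indicE mem_set ?mulr1; last by rewrite /= in_itv/= x1.
  rewrite /IG_density ler_piMr ?powR_ge0// -expR0 ler_expR oppr_le0.
  by rewrite divr_ge0// ltW.
rewrite ge0_integralD//; last 4 first.
- by move=> x _; rewrite lee_fin mulr_ge0// expR_ge0.
- by apply/measurable_EFinP; exact: measurable_funM.
- by move=> x _; rewrite lee_fin.
- exact/measurable_EFinP.
apply: lte_add_pinfty.
  under eq_integral do rewrite EFinM.
  rewrite ge0_integralZl//.
  - by apply: lte_mul_pinfty; rewrite ?lee_fin ?expR_ge0.
  - exact/measurable_EFinP.
  - by move=> x _; rewrite lee_fin.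
apply: le_lt_trans (powR_integral_fin lam0); rewrite [leRHS]integral_mkcond.
by under [leRHS]eq_integral do rewrite restrict_EFin patch_indic.
Qed.

Let F_dK_gt0 (a b x u : R) : 0 <= a -> 0 <= b -> 0 < x -> 0 < u ->
  0 < (F_dK a b x u).1 /\ 0 < (F_dK a b x u).2.
Proof.
move=> a0 b0 x0 u0; rewrite /F_dK/=.
have aff k : 0 <= k -> 0 < 1 + k * x * u.
  by move=> k0; rewrite ltr_wpDr// !mulr_ge0// ltW.
by split; apply: divr_gt0; rewrite ?mulr_gt0 ?aff.
Qed.

Let F_dK_mul (a b x u : R) : 0 <= a -> 0 <= b -> 0 < x -> 0 < u ->
  (F_dK a b x u).1 * (F_dK a b x u).2 = x * u.
Proof.
move=> a0 b0 x0 u0; rewrite /F_dK/=.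
have aff k : 0 <= k -> 1 + k * x * u != 0.
  by move=> k0; rewrite gt_eqF// ltr_wpDr// !mulr_ge0// ltW.
by field; rewrite !aff.
Qed.

(** Isolates a function of [x * u], which [F_dK] preserves; what remains is to check that the
    exponent is an invariant rational function. *)
Let GIG_IG (lam c1 c2 x u : R) : 0 < x -> 0 < u ->
  GIG_density lam c1 c2 x * IG_density lam c2 u =
  (x * u) `^ (- lam - 1) * expR (- (c1 * x + c2 / x + c2 / u)).
Proof.
move=> x0 u0; rewrite /GIG_density /IG_density mulrACA -powRM ?ltW// -expRD.
by congr (_ * expR _); ring.
Qed.

(** The partner [nu] is IG(lam, c). Its mass is finite by comparison with the density of [mu], which
    is integrable because [mu] is a probability. *)
Lemma GIG_preserves_product (a lam c : R) (mu : probability R R) :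
  0 < a -> 0 < lam -> 0 < c -> has_density_prop mu (GIG_density lam (c * a) c) ->
  exists nu : probability R R, nu [set u | u <= 0] = 0%E /\ preserves_product a 0 mu nu.
Proof.
move=> a0 lam0 c0 dmu.
have c10 : 0 <= c * a by rewrite mulr_ge0// ltW.
have mG := measurable_GIG_density lam (c * a) c.
have [k [k0 mug]] := density_prop_pdf mG (@GIG_density_gt0 _ lam (c * a) c) dmu.
have Goo : (\int[lebR]_x (pos_part_fun (GIG_density lam (c * a) c) x)%:E < +oo)%E.
  apply: (pdf_integral_fin k0 _ _ mug).
    by apply: measurable_fun_ifT => //; exact: measurable_fun_ltr.
  by move=> x; rewrite /pos_part_fun; case: ifPn => // /GIG_density_gt0 ?; rewrite ltW.
have [nu [k' [k'0 nuh]]] := normalized_pdf mu (measurable_IG_density lam c)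
  (@IG_density_gt0 _ lam c) (IG_integral_fin lam0 c10 (ltW c0) Goo).
exists nu; split; first exact: has_pdf_le0 nuh.
apply: (pdf_preserves_product mug nuh (ltW a0) (lexx 0)) => x u x0 u0.
have [y0 v0] := F_dK_gt0 (ltW a0) (lexx 0) x0 u0.
rewrite /pos_part_fun x0 u0 y0 v0 [LHS]mulrACA [RHS]mulrACA; congr (_ * _).
rewrite (GIG_IG _ _ _ x0 u0) (GIG_IG _ _ _ y0 v0) (F_dK_mul (ltW a0) (lexx 0) x0 u0).
congr (_ * expR (- _)).
rewrite /F_dK/=; have e : 1 + a * x * u != 0.
  by rewrite gt_eqF// ltr_wpDr// !mulr_ge0// ltW.
by field; rewrite e !gt_eqF//= ; lra.
Qed.

(** Exchanging the roles of site and carrier, the partner is GIG(lam, cb, c), whose density is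
    dominated by that of IG(lam, c). *)
Lemma IG_preserves_product (b lam c : R) (mu : probability R R) :
  0 < b -> 0 < lam -> 0 < c -> has_density_prop mu (IG_density lam c) ->
  exists nu : probability R R, nu [set u | u <= 0] = 0%E /\ preserves_product 0 b mu nu.
Proof.
move=> b0 lam0 c0 dmu.
have c10 : 0 <= c * b by rewrite mulr_ge0// ltW.
have mI := measurable_IG_density lam c.
have mG := measurable_GIG_density lam (c * b) c.
have [k [k0 mug]] := density_prop_pdf mI (@IG_density_gt0 _ lam c) dmu.
have I0 x : 0 <= pos_part_fun (IG_density lam c) x.
  by rewrite /pos_part_fun; case: ifPn => // /IG_density_gt0 ?; rewrite ltW.
have mpI : measurable_fun setT (pos_part_fun (IG_density lam c)).
  by apply: measurable_fun_ifT => //; exact: measurable_fun_ltr.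
have Ioo := pdf_integral_fin k0 mpI I0 mug.
have Goo : (\int[lebR]_x (pos_part_fun (GIG_density lam (c * b) c) x)%:E < +oo)%E.
  apply: le_lt_trans Ioo; apply: ge0_le_integral => //.
  - move=> x _; rewrite lee_fin /pos_part_fun.
    by case: ifPn => // /GIG_density_gt0 ?; rewrite ltW.
  - by apply/measurable_EFinP/measurable_fun_ifT => //; exact: measurable_fun_ltr.
  - exact/measurable_EFinP.
  move=> x _; rewrite lee_fin /pos_part_fun; case: ifPn => // x0.
  rewrite ler_pM2l ?powR_gt0// ler_expR gerDr oppr_le0.
  by rewrite mulr_ge0// ltW.
have [nu [k' [k'0 nuh]]] := normalized_pdf mu mG (@GIG_density_gt0 _ lam (c * b) c) Goo.
exists nu; split; first exact: has_pdf_le0 nuh.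
apply: (pdf_preserves_product mug nuh (lexx 0) (ltW b0)) => x u x0 u0.
have [y0 v0] := F_dK_gt0 (lexx 0) (ltW b0) x0 u0.
rewrite /pos_part_fun x0 u0 y0 v0 [LHS]mulrACA [RHS]mulrACA; congr (_ * _).
rewrite mulrC [RHS]mulrC (GIG_IG _ _ _ u0 x0) (GIG_IG _ _ _ v0 y0) [u * x]mulrC.
rewrite [_.2 * _]mulrC (F_dK_mul (lexx 0) (ltW b0) x0 u0).
congr (_ * expR (- _)).
rewrite /F_dK/=; have e : 1 + b * x * u != 0.
  by rewrite gt_eqF// ltr_wpDr// !mulr_ge0// ltW.
by field; rewrite e !gt_eqF//= ; lra.
Qed.

End gig_pairs.

(** * Burke's argument *)

Section almost_sure.
Context d (T : measurableType d) (R : realType) (P : probability T R).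

Lemma probability_setI1 (A G : set T) : measurable A -> measurable G ->
  P G = 1%E -> P (A `&` G) = P A.
Proof.
move=> mA mG PG; apply/eqP; rewrite eq_le; apply/andP; split.
  by apply: le_measure; rewrite ?inE//; exact: measurableI.
rewrite -[in leLHS](setIT A) -(setUv G) setIUr.
have mAG : measurable (A `&` G) by exact: measurableI.
have mAGc : measurable (A `&` ~` G) by apply: measurableI => //; exact: measurableC.
apply: le_trans (measureU2 _ mAG mAGc) _.
rewrite -[leRHS]adde0 leeD2l//.
apply: (@le_trans _ _ (P (~` G))).
  by apply: le_measure; rewrite ?inE//; exact: measurableC.
by rewrite probability_setC// PG subee.
Qed.

Lemma eq_probability_on (A B G : set T) :
  measurable A -> measurable B -> measurable G -> P G = 1%E ->
  (forall x, G x -> A x <-> B x) -> P A = P B.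
Proof.
move=> mA mB mG PG AB.
rewrite -(probability_setI1 mA mG PG) -(probability_setI1 mB mG PG).
by congr (P _); apply/seteqP; split=> x [xA xG]; split => //; exact/(AB x xG).
Qed.

Lemma probability_bigcap1 (G : nat -> set T) : (forall k, measurable (G k)) ->
  (forall k, P (G k) = 1%E) -> P (\bigcap_k G k) = 1%E.
Proof.
move=> mG PG; have mI : measurable (\bigcap_k G k) by exact: bigcapT_measurable.
have PGC k : P (~` G k) = 0%E by rewrite probability_setC// PG subee.
have PIC : P (~` \bigcap_k G k) = 0%E.
  apply/negligibleP; first exact: measurableC.
  rewrite setC_bigcap; apply: negligible_bigcup => k.
  by apply/negligibleP; [exact: measurableC|exact: PGC].
have -> : P (\bigcap_k G k) = (1 - P (~` \bigcap_k G k))%E.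
  by rewrite -probability_setC ?setCK//; exact: measurableC.
by rewrite PIC sube0.
Qed.

End almost_sure.

Lemma measurable_F_dK_comp (R : realType) (a b : R) d (T : measurableType d)
  (f g : T -> R) : measurable_fun setT f -> measurable_fun setT g ->
  measurable_fun setT (fun w => (F_dK a b (f w) (g w)).1) /\
  measurable_fun setT (fun w => (F_dK a b (f w) (g w)).2).
Proof.
move=> mf mg.
have mF := measurableT_comp (measurable_F_dK a b) (measurable_fun_pair mf mg).
by split; [exact: (measurableT_comp measurable_fst mF)|
           exact: (measurableT_comp measurable_snd mF)].
Qed.

Section step.
Variables (R : realType) (a b : R) (mu nu : probability R R).
Hypothesis pres : preserves_product a b mu nu.
Context d (T : measurableType d) (Q : probability T R).

(** Restricted to the event [G], the pair (xi, V) has law [c] times the product measure, because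
    rectangles determine a finite measure; applying [F_dK] then keeps that law. *)
Lemma preserves_product_step (c : R) (G : set T) (xi V : T -> R) : 0 <= c ->
  measurable G -> measurable_fun setT xi -> measurable_fun setT V ->
  (forall A B, measurable A -> measurable B ->
    Q (G `&` [set w | A (xi w) /\ B (V w)]) = (c%:E * (mu A * nu B))%E) ->
  forall A B, measurable A -> measurable B ->
    Q (G `&` [set w | A (F_dK a b (xi w) (V w)).1 /\ B (F_dK a b (xi w) (V w)).2]) =
    (c%:E * (mu A * nu B))%E.
Proof.
move=> c0 mG mxi mV QE A B mA mB.
have [m' m'E] := pushforward_restr_measure Q (measurable_fun_pair mxi mV) mG.
pose m2 := mscale (NngNum c0) (mu \x nu)%E.
pose S := [set p : R * R | A (F_dK a b p.1 p.2).1 /\ B (F_dK a b p.1 p.2).2].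
have mS : measurable S.
  exact: (measurable_preimage (measurable_F_dK a b) (measurableX mA mB)).
transitivity (m2 S); last by rewrite /m2 /mscale/= pres.
transitivity (m' S); first by rewrite m'E setIC.
pose C : set (set (R * R)) :=
  [set X | exists A B, [/\ measurable A, measurable B & X = A `*` B]].
apply: (measure_unique C (fun=> setT)) mS.
- rewrite measurable_prod_measurableType; congr (<<s _ >>).
  apply/seteqP; split=> [_ [A' mA' [B' mB' <-]]|_ [A' [B' [mA' mB' ->]]]].
    by exists A', B'.
  by exists A' => //; exists B'.
- move=> _ _ [A1 [B1 [mA1 mB1 ->]]] [A2 [B2 [mA2 mB2 ->]]].
  by rewrite -setXI; exists (A1 `&` A2), (B1 `&` B2); split => //; exact: measurableI.
- by move=> _; exists setT, setT; split => //; rewrite setXTT.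
- by apply/seteqP; split=> // x _; exists 0%N.
- move=> _ [A' [B' [mA' mB' ->]]]; rewrite m'E setIC.
  transitivity (c%:E * (mu A' * nu B'))%E; first exact: QE.
  rewrite /m2 /mscale/=; congr (_ * _)%E; exact/esym/product_measure1E.
- by move=> _; rewrite m'E preimage_setT setTI (le_lt_trans (probability_le1 _ _))// ltry.
Qed.

Section burke.
Variables (xi : nat -> T -> R) (V0 : T -> R).
Hypotheses (mxi : forall i, measurable_fun setT (xi i)) (mV0 : measurable_fun setT V0).

(** The carrier entering site [k]: it has absorbed sites 0 to k - 1, and [transported k] is what it
    leaves behind at site [k]. *)
Fixpoint carrier_seq (k : nat) (w : T) : R :=
  if k is j.+1 then (F_dK a b (xi j w) (carrier_seq j w)).2 else V0 w.

Definition transported (k : nat) (w : T) : R :=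
  (F_dK a b (xi k w) (carrier_seq k w)).1.

Lemma measurable_carrier_seq k : measurable_fun setT (carrier_seq k).
Proof.
by elim: k => [//|k IH]; exact: (measurable_F_dK_comp a b (mxi k) IH).2.
Qed.

Lemma measurable_transported k : measurable_fun setT (transported k).
Proof.
exact: (measurable_F_dK_comp a b (mxi k) (measurable_carrier_seq k)).1.
Qed.

(** Induction on the position of the carrier: transported values behind it, the carrier itself and
    the untouched inputs ahead of it remain independent, with laws [mu], [nu] and [mu]. *)
Lemma burke (N : nat) :
  (forall (A : nat -> set R) B, (forall i, measurable (A i)) -> measurable B ->
    Q [set w | B (V0 w) /\ forall i, (i < N)%N -> A i (xi i w)] =
    (nu B * \prod_(i < N) mu (A i))%E) ->
  forall k, (k <= N)%N ->
  forall (A : nat -> set R) B, (forall i, measurable (A i)) -> measurable B ->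
    Q [set w | B (carrier_seq k w) /\ forall i, (i < N)%N ->
         A i (if (i < k)%N then transported i w else xi i w)] =
    (nu B * \prod_(i < N) mu (A i))%E.
Proof.
move=> QE; elim=> [_ A B mA mB|k IH kN A B mA mB]; first by rewrite -QE.
have {}IH := IH (ltnW kN).
(* [G] collects the constraints at all sites except [k], and [c] below is its probability; the step
   changes only the pair formed by site [k] and the carrier. *)
pose G := [set w | forall i, (i < N)%N -> i != k ->
         A i (if (i < k)%N then transported i w else xi i w)].
have mG : measurable G.
  rewrite (_ : G = \bigcap_(i in [set i | (i < N)%N /\ i != k])
     ((fun w => if (i < k)%N then transported i w else xi i w) @^-1` A i)).
    apply: bigcap_measurableType => i _.
    by apply: measurable_preimage => //; case: (i < k)%N; [exact: measurable_transported|].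
  by apply/seteqP; split=> w Gw i; [case; exact: Gw|move=> iN ik; exact: Gw].
pose upd A' := fun i => if i == k then A' else A i.
have mupd A' : measurable A' -> forall i, measurable (upd A' i).
  by move=> mA' i; rewrite /upd; case: ifP.
pose c := (\prod_(i < N | i != Ordinal kN) mu (A i))%E.
have cfin : c \is a fin_num.
  by rewrite /c; elim/big_ind: _ => // *; [exact: fin_numM|exact: fin_num_measure].
have c0 : (0 <= c)%E by apply: prode_ge0.
have prodE A' : (\prod_(i < N) mu (upd A' i) = mu A' * c)%E.
  rewrite (bigD1 (Ordinal kN))//= /upd eqxx; congr (_ * _)%E.
  by apply: eq_bigr => i; rewrite -val_eqE/= => /negbTE ->.
have stepE : forall A' B', measurable A' -> measurable B' ->
    Q (G `&` [set w | A' (xi k w) /\ B' (carrier_seq k w)]) =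
    ((fine c)%:E * (mu A' * nu B'))%E.
  move=> A' B' mA' mB'; rewrite fineK// muleC -muleA (muleC (nu B')) muleA.
  rewrite -prodE muleC -(IH _ _ (mupd _ mA') mB').
  congr (Q _); apply/seteqP; split=> w.
    move=> [Gw [Aw Bw]]; split=> // i iN; rewrite /upd.
    by case: eqVneq => [->|ik]; [rewrite ltnn|exact: Gw].
  move=> [Bw Aw]; split; last split => //.
    by move=> i iN ik; have := Aw i iN; rewrite /upd (negbTE ik).
  by have := Aw k kN; rewrite /upd eqxx ltnn.
have := preserves_product_step (fine_ge0 c0) mG (mxi k) (measurable_carrier_seq k)
  stepE (mA k) mB.
have -> : (\prod_(i < N) mu (A i) = mu (A k) * c)%E.
  by rewrite -prodE; apply: eq_bigr => i _; rewrite /upd; case: eqP => [->|].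
rewrite fineK// => QG; rewrite [RHS](_ : _ = (c * (mu (A k) * nu B))%E); last first.
  by rewrite muleC (muleC (mu _)) -muleA.
apply: etrans QG.
congr (Q _); apply/seteqP; split=> w.
  move=> [Bw Aw]; split; last first.
    by split=> //; have := Aw k kN; rewrite ltnSn.
  move=> i iN ik; have := Aw i iN.
  by rewrite ltnS leq_eqVlt (negbTE ik).
move=> [Gw [Aw Bw]]; split=> // i iN.
have [->|ik] := eqVneq i k; first by rewrite ltnSn.
by have := Gw i iN ik; rewrite ltnS [(i <= k)%N]leq_eqVlt (negbTE ik).
Qed.

End burke.
End step.

(** * Iterated carriers on the two-sided line *)

Section iter.
Variables (R : realType) (a b : R).
Implicit Types (x : Config R).

Fixpoint iter_carrier (K : nat) (n : int) x (u : R) : R :=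
  if K is k.+1 then (F_dK a b (x n) (iter_carrier k (n - 1) x u)).2 else u.

(** Peels off the oldest site instead of the newest. Starting one site earlier amounts to changing
    the initial value, so monotonicity in [u] becomes monotonicity in [K]. *)
Lemma iter_carrierSr K n x u :
  iter_carrier K.+1 n x u = iter_carrier K n x (F_dK a b (x (n - K%:Z)) u).2.
Proof.
elim: K n => [|K IH] n; first by rewrite /= subr0.
transitivity (F_dK a b (x n) (iter_carrier K.+1 (n - 1) x u)).2; first by [].
rewrite IH.
by rewrite /= (_ : n - 1 - K%:Z = n - K.+1%:Z)//; lia.
Qed.

Lemma iter_carrier_dep K n x y u : (forall j, j <= n -> x j = y j) ->
  iter_carrier K n x u = iter_carrier K n y u.
Proof.
elim: K n => [//|K IH] n xy /=; rewrite xy// IH// => j jn; apply: xy; lia.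
Qed.

Lemma measurable_iter_carrier d (T : measurableType d) K n (X : T -> Config R) (u : T -> R) :
  measurable_fun setT X -> measurable_fun setT u ->
  measurable_fun setT (fun w => iter_carrier K n (X w) (u w)).
Proof.
move=> mX mu; elim: K n => [//|K IH] n.
have mXn : measurable_fun setT (fun w => X w n).
  exact: (measurableT_comp (@measurable_coord R n) mX).
exact: (measurable_F_dK_comp a b mXn (IH _)).2.
Qed.

Lemma iter_carrier_seq m j x u :
  iter_carrier j (m + j%:Z) x u =
  carrier_seq a b (fun i (p : Config R * R) => p.1 (m + 1 + i%:Z)) snd j (x, u).
Proof.
elim: j => [//|j IH] /=; rewrite (_ : m + j.+1%:Z - 1 = m + j%:Z); last lia.
by rewrite IH (_ : m + j.+1%:Z = m + 1 + j%:Z)//; lia.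
Qed.

Variables (mu nu : probability R R) (P : probability (Config R) R).
Hypotheses (Pmu : iid_law P mu) (pres : preserves_product a b mu nu).

Lemma measurable_window (m : int) N (A : nat -> set R) : (forall i, measurable (A i)) ->
  measurable [set x : Config R | forall i, (i < N)%N -> A i (x (m + 1 + i%:Z))].
Proof.
move=> mA.
rewrite (_ : [set x | _] = \bigcap_(i in [set i | (i < N)%N])
   ((fun x : Config R => x (m + 1 + i%:Z)) @^-1` A i)).
  apply: bigcap_measurableType => i _.
  by apply: measurable_preimage => //; exact: measurable_coord.
by apply/seteqP; split=> x Ax i iN; exact: Ax.
Qed.

Lemma iid_window (m : int) N (A : nat -> set R) : (forall i, measurable (A i)) ->
  P [set x | forall i, (i < N)%N -> A i (x (m + 1 + i%:Z))] =
  (\prod_(i < N) mu (A i))%E.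
Proof.
move=> mA; rewrite -(Pmu (n := fun i : 'I_N => m + 1 + i%:Z) (A := fun i => A i))//.
  congr (P _); apply/seteqP; split=> x Ax i; first exact: Ax.
  by move=> iN; exact: (Ax (Ordinal iN)).
by move=> i j ij; apply: val_inj => /=; lia.
Qed.

(** Stationarity of [nu]: this is [burke] on the [K] sites ending at [n], with no constraint on the
    transported values. *)
Lemma iter_carrier_law K n (B : set R) : measurable B ->
  (P \x nu)%E [set p | B (iter_carrier K n p.1 p.2)] = nu B.
Proof.
move=> mB; set m := n - K%:Z.
have mxi i : measurable_fun setT (fun p : Config R * R => p.1 (m + 1 + i%:Z)).
  exact: (measurableT_comp (@measurable_coord R _) measurable_fst).
have := @burke _ a b mu nu pres _ _ (P \x nu)%E _ snd mxi measurable_snd K _ K (leqnn K)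
  (fun=> setT) B.
rewrite big1 ?mule1 => [|i _]; last exact: probability_setT.
move=> <- //; last first.
  move=> A B' mA mB'; rewrite -(iid_window m _ mA) muleC.
  transitivity ((P \x nu)%E
     ([set x : Config R | forall i, (i < K)%N -> A i (x (m + 1 + i%:Z))] `*` B')).
    by congr ((P \x nu)%E _); apply/seteqP; split=> -[x u] [].
  by apply: product_measure1E => //; exact: measurable_window.
congr ((P \x nu)%E _); apply/seteqP.
by split=> -[x u] /=; rewrite -iter_carrier_seq /m subrK => // -[].
Qed.

(** Converts a pathwise implication into an inequality between laws. [A'] and [C] are exceptional
    sets for the configuration and for the independent initial value. *)
Lemma iter_carrier_domination K n (A A' : set (Config R)) (B C : set R) :
  measurable A -> measurable A' -> measurable B -> measurable C ->
  (forall x u, A x -> [\/ B (iter_carrier K n x u), A' x | C u]) ->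
  (P A <= nu B + (P A' + nu C))%E.
Proof.
move=> mA mA' mB mC ABC.
have P1 D : measurable D -> P D = (P \x nu)%E (D `*` setT).
  move=> mD; rewrite product_measure1E//; apply/esym.
  by rewrite [X in (_ * X)%E]probability_setT mule1.
have nu1 : nu C = (P \x nu)%E (setT `*` C).
  by rewrite product_measure1E// [X in (X * _)%E]probability_setT mul1e.
rewrite !P1// nu1 -(iter_carrier_law K n mB).
have mE : measurable [set p : Config R * R | B (iter_carrier K n p.1 p.2)].
  by apply: measurable_preimage mB; exact: measurable_iter_carrier.
have mX1 D : measurable D -> measurable (D `*` setT : set (Config R * R)).
  by move=> mD; exact: measurableX.
have mX2 : measurable (setT `*` C : set (Config R * R)) by exact: measurableX.
apply: (@le_trans _ _ ((P \x nu)%E ([set p : Config R * R | B (iter_carrier K n p.1 p.2)]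
   `|` (A' `*` setT `|` setT `*` C)))).
  apply: le_measure; rewrite ?inE//; first exact: mX1.
    by apply: measurableU => //; apply: measurableU => //; exact: mX1.
  move=> [x u] [/= /(ABC _ u)[] ? _]; [by left|by right; left|by right; right].
have mU : measurable (A' `*` setT `|` setT `*` C : set (Config R * R)).
  by apply: measurableU => //; exact: mX1.
apply: le_trans (measureU2 _ mE mU) _; apply: leeD => //.
by apply: measureU2 => //; exact: mX1.
Qed.

(* A carrier [U] that only depends on the past and has law [nu] makes the
   transported configuration i.i.d., by Burke's argument. *)
Section transport.
Variables (U : int -> Config R -> R) (Good : set (Config R)).
Hypothesis mU : forall n, measurable_fun setT (U n).
Hypothesis Udep : forall n x y, (forall j, j <= n -> x j = y j) -> U n x = U n y.
Hypothesis Ulaw : forall n B, measurable B -> P [set x | B (U n x)] = nu B.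
Hypotheses (mGood : measurable Good) (PGood : P Good = 1%E).
Hypothesis UGood : forall x, Good x -> forall n, U n x = (F_dK a b (x n) (U (n - 1) x)).2.

Definition transport x : Config R := fun n => (F_dK a b (x n) (U (n - 1) x)).1.

Lemma measurable_transport : measurable_fun setT transport.
Proof.
apply: measurable_to_config => n.
exact: (measurable_F_dK_comp a b (@measurable_coord R n) (mU (n - 1))).1.
Qed.

Let carrier_past_future (m : int) N (A : nat -> set R) B :
  (forall i, measurable (A i)) -> measurable B ->
  P [set x | B (U m x) /\ forall i, (i < N)%N -> A i (x (m + 1 + i%:Z))] =
  (nu B * \prod_(i < N) mu (A i))%E.
Proof.
move=> mA mB.
pose s := [seq m + 1 + i%:Z | i <- iota 0 N].
pose A' (j : int) := A (absz (j - (m + 1))%R).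
have A'E i : A' (m + 1 + i%:Z) = A i by rewrite /A' addrC addKr.
have mUB : measurable [set x | B (U m x)] by exact: (measurable_preimage (mU m) mB).
have us : uniq s.
  by rewrite map_inj_uniq ?iota_uniq// => i j; lia.
have boxE : box s A' = [set x | forall i, (i < N)%N -> A i (x (m + 1 + i%:Z))].
  apply/seteqP; split=> [x Ax i iN|x Ax _ /mapP[i + ->]].
    rewrite -A'E.
    by apply: Ax; apply/mapP; exists i => //; rewrite mem_iota.
  by rewrite mem_iota /= add0n => iN; rewrite A'E; exact: Ax.
rewrite -(iid_window m _ mA) -(Ulaw m mB) -boxE.
have := @iid_indep _ _ _ Pmu (fun j => j <= m) [set x | B (U m x)] s A' mUB.
move=> <- //.
- by rewrite boxE.
- by move=> x y xy /=; rewrite (Udep xy).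
- by move=> j /mapP[i _ ->]; rewrite -ltNge; lia.
- by move=> j; exact: mA.
Qed.

Lemma transport_invariant E : measurable E -> P (transport @^-1` E) = P E.
Proof.
move=> mE.
have [m' m'E] := pushforward_restr_measure P measurable_transport measurableT.
have -> : P (transport @^-1` E) = m' E by rewrite m'E setIT.
apply: config_measure_unique => //.
  by rewrite m'E preimage_setT setTI (le_lt_trans (probability_le1 _ _))// ltry.
move=> s A us mA; rewrite m'E setIT.
(* All sites of [s] lie between -M and M. The window has these 2M + 1 sites, and the carrier enters
   it from site m = -M - 1. *)
pose M := (\max_(j <- s) absz j)%N.
have sM j : j \in s -> (absz j <= M)%N by move=> js; exact: leq_bigmax_seq.
pose m : int := - (M.+1)%:Z; pose N := (M + M).+1.
pose ix (j : int) := absz (j - (m + 1))%R.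
have ixP j : j \in s -> (ix j < N)%N /\ m + 1 + (ix j)%:Z = j.
  by move=> /sM; rewrite /ix /m /N => ?; split; lia.
pose A' i := if m + 1 + i%:Z \in s then A (m + 1 + i%:Z) else setT.
have mA' i : measurable (A' i) by rewrite /A'; case: ifP.
have boxE : box s A = [set x | forall i, (i < N)%N -> A' i (x (m + 1 + i%:Z))].
  apply/seteqP; split=> x Ax.
    by move=> i iN; rewrite /A'; case: ifPn => // /Ax.
  move=> j js; have [jN je] := ixP j js; have := Ax _ jN.
  by rewrite /A' je js.
have mxi i : measurable_fun setT (fun x : Config R => x (m + 1 + i%:Z)).
  exact: measurable_coord.
(* The finite recursion started from [U m] reproduces [U] at every later site of a good
   configuration, so [burke] speaks about [transport]. *)
pose V := carrier_seq a b (fun i (x : Config R) => x (m + 1 + i%:Z)) (U m).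
have VU x : Good x -> forall j, V j x = U (m + j%:Z) x.
  move=> Gx; elim=> [|j IH]; first by rewrite /V/= addr0.
  rewrite [RHS]UGood// /V/= -/(V j x) IH.
  by congr (F_dK _ _ (x _) (U _ x)).2; lia.
transitivity (P [set x | setT (V N x) /\ forall i, (i < N)%N -> A' i
  (if (i < N)%N then transported a b (fun i (x : Config R) => x (m + 1 + i%:Z)) (U m) i x
   else x (m + 1 + i%:Z))]); last first.
  rewrite (burke pres mxi (mU m) (@carrier_past_future m N) (leqnn N))//.
  by rewrite [X in (X * _)%E]probability_setT mul1e boxE; exact/esym/iid_window.
apply: (eq_probability_on (G := Good)) => //.
- by apply: measurable_preimage; [exact: measurable_transport|exact: measurable_box].
- rewrite (_ : [set x | _] = \bigcap_(i in [set i | (i < N)%N])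
   (transported a b (fun i (x : Config R) => x (m + 1 + i%:Z)) (U m) i @^-1` A' i)).
    apply: bigcap_measurableType => i _; apply: measurable_preimage => //.
    exact: measurable_transported.
  apply/seteqP; split=> x; first by move=> [_ Ax] i iN; have := Ax i iN; rewrite iN.
  by move=> Ax; split=> // i iN; rewrite iN; exact: Ax.
- move=> x Gx.
  have tE i : transported a b (fun i (x : Config R) => x (m + 1 + i%:Z)) (U m) i x =
      transport x (m + 1 + i%:Z).
    rewrite /transported -/(V i x) VU// /transport.
    by congr (F_dK _ _ (x _) (U _ x)).1; lia.
  rewrite boxE; split.
    by move=> Ax; split=> // i iN; rewrite iN tE; exact: Ax.
  by move=> [_ Ax] i iN; have := Ax i iN; rewrite iN tE.
Qed.

End transport.
End iter.

(** * Limits of events and laws, and the limit of the iterated carriers *)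

Lemma probability_bigcap_int1 d (T : measurableType d) (R : realType)
  (P : probability T R) (G : int -> set T) : (forall n, measurable (G n)) ->
  (forall n, P (G n) = 1%E) ->
  measurable (\bigcap_n G n) /\ P (\bigcap_n G n) = 1%E.
Proof.
move=> mG PG.
have mGG k : measurable (G k%:Z `&` G (- k%:Z)) by exact: measurableI.
have -> : \bigcap_n G n = \bigcap_k (G k%:Z `&` G (- k%:Z)).
  apply/seteqP; split=> [x Gx k _|x Gx [k|k] _]; first by split; exact: Gx.
    by have [] := Gx k Logic.I.
  by have [_] := Gx k.+1 Logic.I; rewrite NegzE.
split; first exact: bigcapT_measurable.
apply: probability_bigcap1 => // k.
by rewrite probability_setI1.
Qed.

Lemma measure_bigcup_le d (T : measurableType d) (R : realType)
  (m : {measure set T -> \bar R}) (F : nat -> set T) (c : \bar R) :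
  (forall k, measurable (F k)) -> nondecreasing_seq F ->
  (forall k, m (F k) <= c)%E -> (m (\bigcup_k F k) <= c)%E.
Proof.
move=> mF ndF Fc.
have mFU : measurable (\bigcup_k F k) by exact: bigcupT_measurable.
have cF := nondecreasing_cvg_mu (mu := m) mF mFU ndF.
rewrite -(cvg_lim _ cF)//; apply: lime_le; first by apply/cvg_ex; eexists; exact: cF.
exact: nearW.
Qed.

(** The second comparison leaves a gap r < s, which is what approximation by iterates delivers;
    continuity from below along r + 1/(n+1) closes it. *)
Lemma measure_eq_rays (R : realType) (m1 m2 : {measure set R -> \bar R}) :
  (m1 setT < +oo)%E ->
  (forall r : R, (m1 [set x | (r < x)%R] <= m2 [set x | (r < x)%R])%E) ->
  (forall r s : R, r < s -> (m2 [set x | (s < x)%R] <= m1 [set x | (r < x)%R])%E) ->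
  forall A, measurable A -> m1 A = m2 A.
Proof.
move=> m1oo m12 m21.
have setE (r : R) : [set x | r < x] = `]r, +oo[%classic.
  by apply/seteqP; split=> x; rewrite /= in_itv/= andbT.
have mray (r : R) : measurable [set x | r < x] by rewrite setE.
have e r : m1 [set x | r < x] = m2 [set x | r < x].
  apply/eqP; rewrite eq_le m12/=.
  pose F n := [set x | r + n.+1%:R^-1 < x].
  have FU : \bigcup_n F n = [set x | r < x].
    apply/seteqP; split=> [x [n _]|x /ltr_add_invr[k kx]]; last by exists k.
    by rewrite /F/=; apply: lt_trans; rewrite ltrDl invr_gt0.
  rewrite -FU; apply: measure_bigcup_le => [n|m n mn|n]; first exact: mray.
    apply/subsetPset => x; rewrite /F/=; apply: le_lt_trans.
    by rewrite lerD2l lef_pV2 ?posrE// ler_nat.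
  by rewrite FU; apply: m21; rewrite ltrDl invr_gt0.
move=> A mA; apply: (measure_unique (@RGenOInfty.G R) (fun n => `](- n%:R), +oo[%classic)) => //.
- exact: RGenOInfty.measurableE.
- move=> _ _ [x ->] [y ->]; exists (Num.max x y).
  by rewrite -!setE; apply/seteqP; split=> z /=; rewrite gt_max => /andP.
- by move=> n; exists (- n%:R).
- apply/seteqP; split=> // x _; exists (Num.bound `|x|) => //=; rewrite in_itv/= andbT.
  have := archi_boundP (normr_ge0 x); rewrite ltrNl => /(le_lt_trans _); apply.
  by rewrite -normrN ler_norm.
- by move=> _ [x ->]; rewrite -setE e.
- move=> n; apply: le_lt_trans m1oo; apply: le_measure; rewrite ?inE//.
Qed.

Section limit_carrier.
Variables (R : realType) (a b : R).
Implicit Types (x : Config R).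

(** An upper limit in the extended reals is measurable without any convergence assumption; [fine]
    brings it back to the reals, and it is the limit wherever a real limit exists. *)
Definition limit_carrier (n : int) x : R :=
  fine (limn_esup (fun k => (iter_carrier a b k n x 0)%:E)).

Lemma limit_carrierE n x l :
  iter_carrier a b k n x 0 @[k --> \oo] --> l -> limit_carrier n x = l.
Proof.
move=> il; rewrite /limit_carrier.
have /cvg_limn_einf_sup[_ ->] // : (iter_carrier a b k n x 0)%:E @[k --> \oo] --> l%:E.
by apply: cvg_EFin => //; exact: nearW.
Qed.

Lemma measurable_limit_carrier n : measurable_fun setT (limit_carrier n).
Proof.
apply: measurableT_comp => //.
apply: measurable_fun_limn_esup => k; apply/measurable_EFinP.
exact: measurable_iter_carrier.
Qed.

Lemma limit_carrier_dep n x y : (forall j, j <= n -> x j = y j) ->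
  limit_carrier n x = limit_carrier n y.
Proof.
move=> xy; rewrite /limit_carrier; congr (fine (limn_esup _)).
by apply/funext => k; rewrite (iter_carrier_dep _ _ _ _ xy).
Qed.

Variables (mu nu : probability R R) (P : probability (Config R) R).
Hypotheses (Pmu : iid_law P mu) (pres : preserves_product a b mu nu).
Hypothesis mu_gt0 : mu [set x | 0 < x] = 1%E.
Hypothesis nu_le0 : nu [set x | x <= 0] = 0%E.

Lemma measurable_gtr_set (r : R) : measurable [set x : R | r < x].
Proof. by rewrite -set_itvoy. Qed.

Lemma measurable_ltr_set (r : R) : measurable [set x : R | x < r].
Proof. by rewrite -set_itvNyo. Qed.

Lemma measurable_ler_set (r : R) : measurable [set x : R | x <= r].
Proof. by rewrite -set_itvNyc. Qed.

Definition pos_set : set (Config R) := [set x | forall n, 0 < x n].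

Lemma pos_set_ae : measurable pos_set /\ P pos_set = 1%E.
Proof.
rewrite (_ : pos_set = \bigcap_n [set x : Config R | 0 < x n]); last first.
  by apply/seteqP; split=> x xp n; [move=> _|]; exact: xp.
apply: probability_bigcap_int1 => n.
  exact: (measurable_preimage (@measurable_coord R n) (measurable_gtr_set 0)).
by rewrite (iid_coord Pmu n (measurable_gtr_set 0)).
Qed.

(** If an iterate from 0 has entered [B] by stage [K], then so has the iterate from a positive [u]
    at stage [K], whose law is [nu]. The bound passes to the increasing union over [K]; [idx]
    selects all, the even or the odd iterates. *)
Lemma domination_bigcup n (idx : nat -> nat) (B : set R) : measurable B ->
  (forall x u k K, pos_set x -> 0 < u -> (k <= K)%N ->
    B (iter_carrier a b (idx k) n x 0) -> B (iter_carrier a b (idx K) n x u)) ->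
  (P (\bigcup_k [set x | B (iter_carrier a b (idx k) n x 0)]) <= nu B)%E.
Proof.
move=> mB Bmono.
have mE k : measurable [set x : Config R | B (iter_carrier a b (idx k) n x 0)].
  by apply: measurable_preimage mB; exact: measurable_iter_carrier.
pose F K := \bigcup_(k in [set k | (k <= K)%N]) [set x | B (iter_carrier a b (idx k) n x 0)].
have mF K : measurable (F K).
  by apply: bigcup_measurable => k _.
have FU : \bigcup_K F K = \bigcup_k [set x | B (iter_carrier a b (idx k) n x 0)].
  apply/seteqP; split=> [x [K _ [k _ kx]]|x [k _ kx]]; first by exists k.
  by exists k => //; exists k => /=.
have [mpos Ppos] := pos_set_ae.
have PF K : (P (F K) <= nu B)%E.
  rewrite -[leRHS]adde0 -[X in (_ <= _ + X)%E]adde0.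
  rewrite -[X in (_ <= _ + (X + _))%E](_ : P (~` pos_set) = 0%E); last first.
    by rewrite probability_setC// Ppos subee.
  rewrite -nu_le0; apply: (iter_carrier_domination Pmu pres (K := idx K) (n := n)) => //.
  - exact: measurableC.
  - exact: measurable_ler_set.
  - move=> x u [k kK Bx]; have [xp|?] := pselect (pos_set x); last exact: Or32.
    have [u0|u0] := ltP 0 u; last exact: Or33.
    by apply: Or31; exact: Bmono Bx.
rewrite -FU.
apply: measure_bigcup_le => // K K' KK'; apply/subsetPset => x [k kK kx]; exists k => //=.
exact: leq_trans KK'.
Qed.

End limit_carrier.
Arguments pos_set {R}.

(** * The minimal carrier when beta = 0 *)

Lemma cvg0_lt (R : realType) (u : nat -> \bar R) (e : R) : u @ \oo --> 0%E -> 0 < e ->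
  exists M, (u M < e%:E)%E.
Proof.
move=> u0 e0; apply: contrapT => /forallNP ue.
have : (e%:E <= limn u)%E.
  apply: lime_ge; first by apply/cvg_ex; eexists; exact: u0.
  by apply: nearW => n; rewrite leNgt; apply/negP; exact: ue.
by rewrite (cvg_lim _ u0)// lee_fin leNgt e0.
Qed.

Lemma probability_gtr_small (R : realType) (m : probability R R) (e : R) : 0 < e ->
  exists M : nat, (m [set y | (M%:R < y)%R] < e%:E)%E.
Proof.
move=> e0; pose F (M : nat) := [set y : R | M%:R < y].
have FI : \bigcap_M F M = set0.
  apply/seteqP; split=> // y Fy; have := Fy (Num.bound `|y|) Logic.I.
  have := le_lt_trans (ler_norm y) (archi_boundP (normr_ge0 y)).
  by move=> /lt_trans/[apply]; rewrite ltxx.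
have mF M : measurable (F M) by exact: measurable_gtr_set.
have cF : m \o F @ \oo --> m (\bigcap_M F M).
  apply: nonincreasing_cvg_mu => //.
  - by rewrite (le_lt_trans (probability_le1 _ _))// ltry.
  - by rewrite FI.
  - move=> M N MN; apply/subsetPset => y; rewrite /F/=; apply: le_lt_trans.
    by rewrite ler_nat.
by rewrite FI measure0 in cF; exact: cvg0_lt.
Qed.

Section beta0.
Variables (R : realType) (a : R).
Hypothesis a0 : 0 <= a.
Implicit Types (x : Config R).
Local Notation it := (iter_carrier a 0).

Lemma F_dK_beta0 (y u : R) : (F_dK a 0 y u).2 = y + a * y ^+ 2 * u.
Proof. by rewrite /F_dK/= !mul0r addr0 divr1; ring. Qed.

Lemma iter_beta0S K n x u : it K.+1 n x u = x n + a * x n ^+ 2 * it K (n - 1) x u.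
Proof. exact: F_dK_beta0. Qed.

(** The slope does not depend on [u], so the influence of the initial value can be read off from a
    single increment. *)
Lemma iter_affine K n x : pos_set x ->
  exists2 p, 0 <= p & forall u, it K n x u = it K n x 0 + p * u.
Proof.
move=> xp; elim: K n => [|K IH] n; first by exists 1 => // u; rewrite /= add0r mul1r.
have [p p0 pE] := IH (n - 1); exists (a * x n ^+ 2 * p).
  by rewrite mulr_ge0// mulr_ge0// sqr_ge0.
by move=> u; rewrite !iter_beta0S (pE u); ring.
Qed.

Lemma le_iter_carrier K n x u v : pos_set x -> u <= v -> it K n x u <= it K n x v.
Proof.
move=> xp uv; have [p p0 pE] := iter_affine K n xp.
by rewrite (pE u) (pE v) lerD2l ler_wpM2l.
Qed.

Lemma iter_carrier0_nd n x : pos_set x -> nondecreasing_seq (fun K => it K n x 0).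
Proof.
move=> xp; apply/nondecreasing_seqP => K; rewrite iter_carrierSr F_dK_beta0 mulr0 addr0.
by apply: le_iter_carrier => //; exact: ltW.
Qed.

Definition bounded_iter : set (Config R) :=
  pos_set `&` \bigcap_n \bigcup_M \bigcap_K [set x : Config R | it K n x 0 <= M%:R].

Lemma bounded_iter_cvg x : bounded_iter x -> forall n,
  it K n x 0 @[K --> \oo] --> limit_carrier a 0 n x.
Proof.
move=> [xp xb] n; have [M _ xM] := xb n Logic.I.
have ic : cvgn (fun K => it K n x 0).
  apply: nondecreasing_is_cvgn; first exact: iter_carrier0_nd.
  by exists M%:R => _ [K _ <-]; exact: xM.
by rewrite (limit_carrierE ic).
Qed.

Lemma iter_le_limit x n K : bounded_iter x -> it K n x 0 <= limit_carrier a 0 n x.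
Proof.
move=> xG; have ic := @bounded_iter_cvg x xG n.
rewrite -(cvg_lim _ ic)//; apply: nondecreasing_cvgn_le.
  by apply: iter_carrier0_nd; case: xG.
by apply/cvg_ex; eexists; exact: ic.
Qed.

Lemma limit_carrier_rec x n : bounded_iter x ->
  limit_carrier a 0 n x = (F_dK a 0 (x n) (limit_carrier a 0 (n - 1) x)).2.
Proof.
move=> xG; apply: limit_carrierE; rewrite -(cvg_shiftS (fun K => it K n x 0)).
rewrite F_dK_beta0; under eq_fun do rewrite iter_beta0S.
by apply: cvgD; [exact: cvg_cst|apply: cvgMr; exact: bounded_iter_cvg].
Qed.

Lemma limit_carrier_gt0 x n : bounded_iter x -> 0 < limit_carrier a 0 n x.
Proof.
move=> xG; apply: lt_le_trans (iter_le_limit n 1 xG).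
by rewrite iter_beta0S mulr0 addr0; case: xG => + _; exact.
Qed.

Variables (mu nu : probability R R) (P : probability (Config R) R).
Hypotheses (Pmu : iid_law P mu) (pres : preserves_product a 0 mu nu).
Hypothesis mu_gt0 : mu [set x | 0 < x] = 1%E.
Hypothesis nu_le0 : nu [set x | x <= 0] = 0%E.

Let measurable_iter K n (u : R) : measurable_fun setT (fun x : Config R => it K n x u).
Proof. exact: measurable_iter_carrier. Qed.

Let sup_law n (r : R) :
  (P (\bigcup_k [set x | (r < it k n x 0)%R]) <= nu [set y | (r < y)%R])%E.
Proof.
apply: (domination_bigcup Pmu pres mu_gt0 nu_le0 (idx := id)).
  exact: measurable_gtr_set.
move=> x u k K xp u0 kK /= rk; apply: lt_le_trans rk _.
apply: le_trans (le_iter_carrier K n xp (ltW u0)).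
exact: iter_carrier0_nd.
Qed.

(** By [sup_law], the supremum of the iterates exceeds M with probability at most that of [nu]
    beyond M, which is arbitrarily small. *)
Lemma bounded_iter_ae : measurable bounded_iter /\ P bounded_iter = 1%E.
Proof.
have [mpos Ppos] := pos_set_ae Pmu mu_gt0.
have mle K n (M : R) : measurable [set x : Config R | it K n x 0 <= M].
  exact: (measurable_preimage (measurable_iter K n 0) (measurable_ler_set M)).
have mBd n : measurable (\bigcup_M \bigcap_K [set x : Config R | it K n x 0 <= M%:R]).
  by apply: bigcupT_measurable => M; exact: bigcapT_measurable.
have PBd n : P (\bigcup_M \bigcap_K [set x : Config R | it K n x 0 <= M%:R]) = 1%E.
  have PBdC : P (~` \bigcup_M \bigcap_K [set x : Config R | it K n x 0 <= M%:R]) = 0%E.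
    apply/eqP; rewrite eq_le measure_ge0 andbT; apply/lee_addgt0Pr => e e0.
    have [M nuM] := probability_gtr_small nu e0.
    rewrite add0e; apply: le_trans (ltW nuM); apply: le_trans (sup_law n M%:R).
    apply: le_measure; rewrite ?inE//.
    - exact: measurableC.
    - apply: bigcupT_measurable => K.
      exact: (measurable_preimage (measurable_iter K n 0) (measurable_gtr_set _)).
    move=> x; rewrite setC_bigcup => /(_ M Logic.I).
    by rewrite setC_bigcap => -[K _ /negP]; rewrite -ltNge; exists K.
  by rewrite -[X in P X]setCK probability_setC ?PBdC ?sube0//; exact: measurableC.
have [mI PI] := probability_bigcap_int1 mBd PBd.
by split; [exact: measurableI|rewrite probability_setI1].
Qed.

Let increment_small n (eta e : R) : 0 < eta -> 0 < e ->
  exists K, (P [set x | (eta < it K.+1 n x 0 - it K n x 0)%R] < e%:E)%E.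
Proof.
move=> eta0 e0.
pose D K := [set x : Config R | eta < it K.+1 n x 0 - it K n x 0].
have mD K : measurable (D K).
  have mf : measurable_fun setT (fun x : Config R => it K.+1 n x 0 - it K n x 0).
    exact: measurable_funB.
  exact: (measurable_preimage mf (measurable_gtr_set eta)).
(* [F K] says that some increment from stage [K] on exceeds [eta]. These events decrease to a null
   set, since the iterates converge almost surely. *)
pose F K := \bigcup_(j in [set j | (K <= j)%N]) D j.
have mF K : measurable (F K) by exact: bigcup_measurable.
have mFI : measurable (\bigcap_K F K) by exact: bigcapT_measurable.
have [mG PG] := bounded_iter_ae.
have PFI : P (\bigcap_K F K) = 0%E.
  apply/eqP; rewrite eq_le measure_ge0 andbT.
  rewrite -[leRHS](_ : P (~` bounded_iter) = 0%E); last first.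
    by rewrite probability_setC// PG subee.
  apply: le_measure; rewrite ?inE//; first exact: measurableC.
  move=> x Fx xG.
  have ic := @bounded_iter_cvg x xG n.
  have ic1 : it K.+1 n x 0 @[K --> \oo] --> limit_carrier a 0 n x.
    by have := ic; rewrite -(cvg_shiftS (fun K => it K n x 0)).
  have /cvgrPdist_lt cvg0 : (fun K => it K.+1 n x 0 - it K n x 0) @ \oo --> (0 : R).
    by have := cvgB ic1 ic; rewrite subrr; exact.
  have [K _ KP] := cvg0 _ eta0.
  have [j Kj] := Fx K Logic.I; rewrite /D/= => jx.
  have := KP j Kj; rewrite /= sub0r normrN => /ltW/(le_trans (ler_norm _)).
  by rewrite leNgt jx.
have cF : P \o F @ \oo --> P (\bigcap_K F K).
  apply: nonincreasing_cvg_mu => //.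
  - by rewrite (le_lt_trans (probability_le1 _ _))// ltry.
  - move=> K K' KK'; apply/subsetPset => x [j /= jK jx]; exists j => //=.
    exact: leq_trans jK.
rewrite PFI in cF.
have [K PK] := cvg0_lt cF e0.
exists K; apply: le_lt_trans PK; apply: le_measure; rewrite ?inE//; first exact: (mD K).
by move=> x Dx; exists K => /=.
Qed.

(** The upper bound is [sup_law]. For the lower one, the iterate from [u] exceeds the iterate from 0
    by px(1 + axu), where x is the oldest site and px is the last increment; this is small because
    increments tend to 0 in probability while x and u are tight. *)
Lemma limit_carrier_law n (A : set R) : measurable A ->
  P [set x | A (limit_carrier a 0 n x)] = nu A.
Proof.
move=> mA.
have mU : measurable_fun setT (limit_carrier a 0 n : Config R -> R).
  exact: measurable_limit_carrier.
have [mG PG] := bounded_iter_ae.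
have PGC : P (~` bounded_iter) = 0%E by rewrite probability_setC// PG subee.
have [m' m'E] := pushforward_restr_measure P mU measurableT.
transitivity (m' A); first by rewrite m'E setIT.
apply: measure_eq_rays mA => [|r|r s rs].
- by rewrite m'E preimage_setT setTI (le_lt_trans (probability_le1 _ _))// ltry.
- have mray := measurable_preimage mU (measurable_gtr_set r).
  rewrite m'E setIT -[leLHS](probability_setI1 mray mG PG).
  apply: le_trans (sup_law n r); apply: le_measure; rewrite ?inE//.
  + exact: measurableI.
  + apply: bigcupT_measurable => K.
    exact: (measurable_preimage (measurable_iter K n 0) (measurable_gtr_set _)).
  move=> x [rx xG]; apply: contrapT => nx; move: rx; apply/negP; rewrite -leNgt.
  have ic := @bounded_iter_cvg x xG n.
  rewrite -(cvg_lim _ ic)//; apply: limr_le; first by apply/cvg_ex; eexists; exact: ic.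
  apply: nearW => K; rewrite leNgt; apply/negP => rK; apply: nx; by exists K.
have mU1 := measurable_preimage mU (measurable_ler_set r).
suff le_rs : (P [set x | (limit_carrier a 0 n x <= r)%R] <= nu [set y | (y <= s)%R])%E.
  have nuE : nu [set y | s < y] = (1 - nu [set y | (y <= s)%R])%E.
    rewrite -probability_setC; last exact: measurable_ler_set.
    by congr (nu _); apply/seteqP; split=> y /=; rewrite ltNge => /negP.
  rewrite [leLHS]nuE m'E setIT.
  rewrite [leRHS](_ : _ = 1 - P [set x | (limit_carrier a 0 n x <= r)%R])%E.
    exact: leeB.
  rewrite -probability_setC//.
  by congr (P _); apply/seteqP; split=> y /=; rewrite ltNge => /negP.
apply/lee_addgt0Pr => e e0.
(* One third each for a large increment, a large oldest site and a large initial value. *)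
have e30 : 0 < e / 3 by rewrite divr_gt0.
have [M1 muM1] := probability_gtr_small mu e30.
have [M2 nuM2] := probability_gtr_small nu e30.
(* Chosen so that an increment at most [eta], amplified by at most 1 + a M1 M2, stays within the gap
   s - r. *)
pose eta := (s - r) / (1 + a * M1%:R * M2%:R).
have c0 : 0 < 1 + a * M1%:R * M2%:R by rewrite ltr_wpDr// !mulr_ge0.
have eta0 : 0 < eta by rewrite divr_gt0// subr_gt0.
have [K PK] := increment_small n eta0 e30.
pose D := [set x : Config R | eta < it K.+1 n x 0 - it K n x 0].
pose X := [set x : Config R | M1%:R < x (n - K%:Z)].
have mD : measurable D.
  have mf : measurable_fun setT (fun x : Config R => it K.+1 n x 0 - it K n x 0).
    exact: measurable_funB.
  exact: (measurable_preimage mf (measurable_gtr_set eta)).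
have mX : measurable X.
  exact: (measurable_preimage (@measurable_coord R _) (measurable_gtr_set _)).
have mGC : measurable (~` bounded_iter) by exact: measurableC.
have mDX : measurable (D `|` X) by exact: measurableU.
have PX : P X = mu [set y | M1%:R < y] by rewrite (iid_coord Pmu _ (measurable_gtr_set _)).
have m0 := @measurable_ler_set R 0.
have mM2 := measurable_gtr_set (M2%:R : R).
apply: le_trans (iter_carrier_domination (K := K.+1) (n := n) Pmu pres
  (A' := (D `|` X) `|` ~` bounded_iter) (C := [set u | u <= 0] `|` [set u | M2%:R < u])
  (B := [set y | y <= s]) mU1 _ _ _ _) _.
- exact: measurableU.
- exact: measurable_ler_set.
- exact: measurableU.
- move=> x u Ux.
  have [xG|?] := pselect (bounded_iter x); last by apply: Or32; right.
  have [u0|u0] := ltP 0 u; last by apply: Or33; left.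
  have [uM|uM] := leP u M2%:R; last by apply: Or33; right.
  have [xM|xM] := leP (x (n - K%:Z)) M1%:R; last by apply: Or32; left; right.
  have [dx|dx] := leP (it K.+1 n x 0 - it K n x 0) eta; last by apply: Or32; left; left.
  apply: Or31; suff : it K.+1 n x u <= s by [].
  have xp : pos_set x by case: xG.
  have [p p0 pE] := iter_affine K n xp.
  have Sr := le_trans (iter_le_limit n K xG) Ux.
  have S1 v : it K.+1 n x v = it K n x 0 + p * (x (n - K%:Z) + a * x (n - K%:Z) ^+ 2 * v).
    by rewrite iter_carrierSr F_dK_beta0 pE.
  have px : p * x (n - K%:Z) <= eta by move: dx; rewrite S1 mulr0 addr0 addrAC subrr add0r.
  rewrite S1.
  rewrite (_ : _ + _ = it K n x 0 + (p * x (n - K%:Z)) * (1 + a * x (n - K%:Z) * u)); last ring.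
  have -> : s = r + eta * (1 + a * M1%:R * M2%:R) by rewrite divfK ?gt_eqF// addrC subrK.
  have xK0 := xp (n - K%:Z).
  apply: lerD => //; apply: ler_pM => //.
  + by rewrite mulr_ge0// ltW.
  + by rewrite ltW// ltr_wpDr// !mulr_ge0// ltW.
  by rewrite lerD2l ler_pM ?mulr_ge0 ?ler_wpM2l// ltW.
rewrite leeD2l//.
have -> : (e%:E = (e / 3)%:E + (e / 3)%:E + (e / 3)%:E)%E by rewrite -!EFinD; congr (_%:E); field.
apply: leeD.
  apply: le_trans (measureU2 _ mDX mGC) _; rewrite [X in (_ + X)%E]PGC adde0.
  apply: le_trans (measureU2 _ mD mX) _; apply: leeD; first exact: ltW.
  by rewrite [leLHS]PX ltW.
by apply: le_trans (measureU2 _ m0 mM2) _; rewrite [X in (X + _)%E]nu_le0 add0e ltW.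
Qed.

End beta0.

(** * The carrier when alpha = 0 *)

Section alpha0.
Variables (R : realType) (b : R).
Hypothesis b0 : 0 < b.
Implicit Types (x : Config R).
Local Notation it := (iter_carrier 0 b).

Lemma F_dK_alpha0 (y u : R) : (F_dK 0 b y u).2 = y / (1 + b * y * u).
Proof. by rewrite /F_dK/= !mul0r addr0 mulr1. Qed.

Lemma iter_alpha0S K n x u : it K.+1 n x u = x n / (1 + b * x n * it K (n - 1) x u).
Proof. exact: F_dK_alpha0. Qed.

Let den_gt0 (y u : R) : 0 < y -> 0 <= u -> 0 < 1 + b * y * u.
Proof. by move=> y0 u0; rewrite ltr_wpDr// !mulr_ge0// ltW. Qed.

Lemma iter_alpha0_ge0 K n x u : pos_set x -> 0 <= u -> 0 <= it K n x u.
Proof.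
move=> xp u0; elim: K n => [//|K IH] n; rewrite iter_alpha0S divr_ge0//; first exact: ltW.
by rewrite ltW// den_gt0.
Qed.

Let le_F (y u v : R) : 0 < y -> 0 <= u -> u <= v ->
  y / (1 + b * y * v) <= y / (1 + b * y * u).
Proof.
move=> y0 u0 uv; rewrite ler_pM2l// lef_pV2 ?posrE ?den_gt0 ?(le_trans u0)//.
by rewrite lerD2l ler_wpM2l// mulr_ge0// ltW.
Qed.

(** One step is decreasing in the carrier, so the direction of monotonicity alternates with the
    parity of [K]. *)
Lemma iter_alpha0_mono K n x u v : pos_set x -> 0 <= u -> u <= v ->
  if odd K then it K n x v <= it K n x u else it K n x u <= it K n x v.
Proof.
move=> xp u0 uv; have v0 := le_trans u0 uv; elim: K n => [//|K IH] n.
rewrite oddS !iter_alpha0S; have := IH (n - 1); case: (odd K) => /= ?;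
by apply: le_F => //; exact: iter_alpha0_ge0.
Qed.

Lemma iter_even_le k n x u : pos_set x -> 0 <= u -> it k.*2 n x 0 <= it k.*2 n x u.
Proof. by move=> xp u0; have := iter_alpha0_mono k.*2 n xp (lexx 0) u0; rewrite odd_double. Qed.

Lemma iter_odd_ge k n x u : pos_set x -> 0 <= u -> it k.*2.+1 n x u <= it k.*2.+1 n x 0.
Proof.
by move=> xp u0; have := iter_alpha0_mono k.*2.+1 n xp (lexx 0) u0; rewrite /= odd_double.
Qed.

Let F_ge0 (y u : R) : 0 < y -> 0 <= u -> 0 <= (F_dK 0 b y u).2.
Proof. by move=> y0 u0; rewrite F_dK_alpha0 divr_ge0// ltW// den_gt0. Qed.

Lemma iter_even_nd n x : pos_set x -> nondecreasing_seq (fun k => it k.*2 n x 0).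
Proof.
move=> xp; apply/nondecreasing_seqP => k; rewrite doubleS !iter_carrierSr.
by apply: iter_even_le => //; do !apply: F_ge0.
Qed.

Lemma iter_odd_ni n x : pos_set x -> nonincreasing_seq (fun k => it k.*2.+1 n x 0).
Proof.
move=> xp; apply/nonincreasing_seqP => k; rewrite doubleS.
rewrite [X in X <= _]iter_carrierSr [X in X <= _]iter_carrierSr.
by apply: iter_odd_ge => //; do !apply: F_ge0.
Qed.

Definition even_limit n x : R := fine (limn_esup (fun k => (it k.*2 n x 0)%:E)).
Definition odd_limit n x : R := fine (limn_esup (fun k => (it k.*2.+1 n x 0)%:E)).

Let fine_limn_esup (u : nat -> R) l : u @ \oo --> l -> fine (limn_esup (EFin \o u)) = l.
Proof.
move=> ul; have /cvg_limn_einf_sup[_ ->] // : (EFin \o u) @ \oo --> l%:E.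
by apply: cvg_EFin => //; exact: nearW.
Qed.

Lemma even_limit_cvg n x : pos_set x -> it k.*2 n x 0 @[k --> \oo] --> even_limit n x.
Proof.
move=> xp; have ic : cvgn (fun k => it k.*2 n x 0).
  apply: nondecreasing_is_cvgn; first exact: iter_even_nd.
  exists (x n) => _ [k _ <-]; case: k => [|k]; first exact: ltW.
  rewrite doubleS iter_alpha0S ler_pdivrMr ?den_gt0 ?iter_alpha0_ge0//.
  have xn0 := ltW (xp n); rewrite mulrDr mulr1 lerDl.
  by apply: mulr_ge0 => //; apply: mulr_ge0; [rewrite mulr_ge0// ltW|exact: iter_alpha0_ge0].
by rewrite /even_limit (fine_limn_esup ic).
Qed.

Lemma odd_limit_cvg n x : pos_set x -> it k.*2.+1 n x 0 @[k --> \oo] --> odd_limit n x.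
Proof.
move=> xp; have ic : cvgn (fun k => it k.*2.+1 n x 0).
  apply: nonincreasing_is_cvgn; first exact: iter_odd_ni.
  by exists 0 => _ [k _ <-]; exact: iter_alpha0_ge0.
by rewrite /odd_limit (fine_limn_esup ic).
Qed.

Lemma even_limit_ge n x k : pos_set x -> it k.*2 n x 0 <= even_limit n x.
Proof.
move=> xp; have ic := @even_limit_cvg n x xp.
rewrite -(cvg_lim _ ic)//; apply: (nondecreasing_cvgn_le (iter_even_nd n xp)).
by apply/cvg_ex; eexists; exact: ic.
Qed.

Lemma even_limit_ge0 n x : pos_set x -> 0 <= even_limit n x.
Proof. by move=> xp; exact: (even_limit_ge n 0 xp). Qed.

Lemma even_le_odd_limit n x : pos_set x -> even_limit n x <= odd_limit n x.
Proof.
move=> xp; have ic := @even_limit_cvg n x xp; have oc := @odd_limit_cvg n x xp.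
rewrite -(cvg_lim _ ic)// -(cvg_lim _ oc)//; apply: ler_lim.
- by apply/cvg_ex; eexists; exact: ic.
- by apply/cvg_ex; eexists; exact: oc.
apply: nearW => k; rewrite iter_carrierSr; apply: iter_even_le => //; exact: F_ge0.
Qed.

Lemma odd_limit_ge0 n x : pos_set x -> 0 <= odd_limit n x.
Proof. by move=> xp; exact: le_trans (even_limit_ge0 n xp) (even_le_odd_limit n xp). Qed.

Let F_cvg n x (u : nat -> R) l : pos_set x -> u @ \oo --> l -> 0 <= l ->
  x n / (1 + b * x n * u k) @[k --> \oo] --> x n / (1 + b * x n * l).
Proof.
move=> xp ul l0; apply: cvgMr; apply: cvgV; first by rewrite gt_eqF// den_gt0.
by apply: cvgD; [exact: cvg_cst|exact: cvgMr].
Qed.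

Lemma odd_limit_rec n x : pos_set x ->
  odd_limit n x = x n / (1 + b * x n * even_limit (n - 1) x).
Proof.
move=> xp; apply: fine_limn_esup.
under eq_fun do rewrite iter_alpha0S.
exact: (F_cvg (n := n) xp (@even_limit_cvg (n - 1) x xp) (even_limit_ge0 _ xp)).
Qed.

Lemma even_limit_rec n x : pos_set x ->
  even_limit n x = x n / (1 + b * x n * odd_limit (n - 1) x).
Proof.
move=> xp; apply: fine_limn_esup; rewrite -(cvg_shiftS (fun k => it k.*2 n x 0)).
under eq_fun do rewrite doubleS iter_alpha0S.
exact: (F_cvg (n := n) xp (@odd_limit_cvg (n - 1) x xp) (odd_limit_ge0 _ xp)).
Qed.

Lemma even_limit_gt0 n x : pos_set x -> 0 < even_limit n x.
Proof. by move=> xp; rewrite even_limit_rec// divr_gt0// den_gt0// odd_limit_ge0. Qed.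

Lemma odd_limit_gt0 n x : pos_set x -> 0 < odd_limit n x.
Proof. by move=> xp; exact: lt_le_trans (even_limit_gt0 n xp) (even_le_odd_limit n xp). Qed.

Lemma measurable_even_limit n : measurable_fun setT (even_limit n).
Proof.
apply: measurableT_comp => //; apply: measurable_fun_limn_esup => k.
by apply/measurable_EFinP; exact: measurable_iter_carrier.
Qed.

Lemma measurable_odd_limit n : measurable_fun setT (odd_limit n).
Proof.
apply: measurableT_comp => //; apply: measurable_fun_limn_esup => k.
by apply/measurable_EFinP; exact: measurable_iter_carrier.
Qed.

Lemma even_limit_dep n x y : (forall j, j <= n -> x j = y j) ->
  even_limit n x = even_limit n y.
Proof.
move=> xy; rewrite /even_limit; congr (fine (limn_esup _)).
by apply/funext => k; rewrite (iter_carrier_dep _ _ _ _ xy).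
Qed.

(* Successive ratios of the two limits increase strictly as long as the limits
   differ. *)
Lemma ratio_limit_le n x : pos_set x ->
  even_limit (n - 1) x / odd_limit (n - 1) x <= even_limit n x / odd_limit n x
  ?= iff (even_limit (n - 1) x == odd_limit (n - 1) x).
Proof.
move=> xp; rewrite [even_limit n x]even_limit_rec// [odd_limit n x]odd_limit_rec//.
have L0 := even_limit_gt0 (n - 1) xp; have H0 := odd_limit_gt0 (n - 1) xp.
have LH := even_le_odd_limit (n - 1) xp.
move: (even_limit _ _) (odd_limit _ _) L0 H0 LH => L H L0 H0 LH.
have dL := den_gt0 (xp n) (ltW L0); have dH := den_gt0 (xp n) (ltW H0).
have -> : x n / (1 + b * x n * H) / (x n / (1 + b * x n * L)) =
    (1 + b * x n * L) / (1 + b * x n * H).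
  by field; rewrite !gt_eqF ?xp.
have e : (1 + b * x n * L) / (1 + b * x n * H) - L / H = (H - L) / (H * (1 + b * x n * H)).
  by field; rewrite !gt_eqF.
have HD : 0 < H * (1 + b * x n * H) by rewrite mulr_gt0.
split; first by rewrite -subr_ge0 e divr_ge0 ?subr_ge0// ltW.
rewrite eq_sym -subr_eq0 e mulf_eq0 invr_eq0 (gt_eqF HD) orbF subr_eq0 eq_sym//.
Qed.

(** A carrier is its own [K]-step iterate from its positive value at n - K, so iterates from 0 bound
    it from below for even [K] and from above for odd [K]. *)
Lemma carrier_between x (U : int -> R) n : pos_set x -> (forall m, 0 < U m) ->
  (forall m, (F_dK 0 b (x m) (U (m - 1))).2 = U m) ->
  even_limit n x <= U n <= odd_limit n x.
Proof.
move=> xp U0 UE.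
have Uit K m : U m = it K m x (U (m - K%:Z)).
  elim: K m => [|K IH] m; first by rewrite /= subr0.
  rewrite -UE (IH (m - 1)) (_ : m - K.+1%:Z = m - 1 - K%:Z)//; lia.
have ic := @even_limit_cvg n x xp; have oc := @odd_limit_cvg n x xp.
apply/andP; split.
  rewrite -(cvg_lim _ ic)//; apply: limr_le; first by apply/cvg_ex; eexists; exact: ic.
  by apply: nearW => k; rewrite (Uit k.*2 n); apply: iter_even_le => //; exact: ltW.
rewrite -(cvg_lim _ oc)//; apply: limr_ge; first by apply/cvg_ex; eexists; exact: oc.
by apply: nearW => k; rewrite (Uit k.*2.+1 n); apply: iter_odd_ge => //; exact: ltW.
Qed.

Variables (mu nu : probability R R) (P : probability (Config R) R).
Hypotheses (Pmu : iid_law P mu) (pres : preserves_product 0 b mu nu).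
Hypothesis mu_gt0 : mu [set x | 0 < x] = 1%E.
Hypothesis nu_le0 : nu [set x | x <= 0] = 0%E.

Definition equal_limits : set (Config R) :=
  pos_set `&` \bigcap_n [set x : Config R | odd_limit n x <= even_limit n x].

Let it_shift K n x u : it K n x u = it K (n - 1) (config_reindex (fun j => j + 1) x) u.
Proof.
elim: K n => [//|K IH] n; rewrite !iter_alpha0S IH /config_reindex.
by rewrite (_ : n - 1 + 1 = n)//; lia.
Qed.

(** The ratio of the limits does not decrease from n to n + 1, yet its law is shift invariant. Hence
    it almost surely crosses no rational level, whereas distinct limits would force a strict
    increase. *)
Let limits_ae_eq n : measurable [set x : Config R | odd_limit n x <= even_limit n x] /\
  P [set x : Config R | odd_limit n x <= even_limit n x] = 1%E.
Proof.
have mratio m : measurable_fun setT (fun x : Config R => even_limit m x / odd_limit m x).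
  apply: measurable_funM; first exact: measurable_even_limit.
  by apply: measurable_invr; exact: measurable_odd_limit.
pose D (q : rat) m := [set x : Config R | ratr q < even_limit m x / odd_limit m x].
have mD q m : measurable (D q m).
  exact: (measurable_preimage (mratio m) (measurable_gtr_set _)).
have [mpos Ppos] := pos_set_ae Pmu mu_gt0.
have DS q : P (D q (n + 1)) = P (D q n).
  have sinj : injective (fun j : int => j + 1) by exact: addIr.
  rewrite -(iid_reindex Pmu sinj (mD q n)); congr (P _).
  have e : forall x, even_limit (n + 1) x = even_limit n (config_reindex (fun j => j + 1) x).
    move=> x; rewrite /even_limit; congr (fine (limn_esup _)); apply/funext => k.
    by rewrite it_shift addrK.
  have o : forall x, odd_limit (n + 1) x = odd_limit n (config_reindex (fun j => j + 1) x).
    move=> x; rewrite /odd_limit; congr (fine (limn_esup _)); apply/funext => k.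
    by rewrite it_shift addrK.
  by apply/seteqP; split=> x; rewrite /D/= e o.
have mle : measurable [set x : Config R | odd_limit n x <= even_limit n x].
  have mf : measurable_fun setT (fun x : Config R => odd_limit n x - even_limit n x).
    by apply: measurable_funB; [exact: measurable_odd_limit|exact: measurable_even_limit].
  rewrite (_ : [set x | _] = (fun x : Config R => odd_limit n x - even_limit n x) @^-1`
    [set y | y <= 0]).
    exact: (measurable_preimage mf (measurable_ler_set 0)).
  by apply/seteqP; split=> x /=; rewrite subr_le0.
split=> //.
have PposC : P (~` pos_set) = 0%E by rewrite probability_setC// Ppos subee.
have D0 q : P (D q (n + 1) `&` ~` D q n) = 0%E.
  have e : P (D q n `&` pos_set) = P (D q n) by exact: probability_setI1.
  have mDn : measurable (D q n `&` pos_set) by exact: measurableI.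
  have sub : D q n `&` pos_set `<=` D q (n + 1).
    move=> x [Dx xp]; apply: lt_le_trans Dx _.
    by have [+ _] := ratio_limit_le (n + 1) xp; rewrite addrK.
  apply/eqP; rewrite eq_le measure_ge0 andbT.
  apply: (@le_trans _ _ (P (D q (n + 1) `\` (D q n `&` pos_set)))).
    apply: le_measure; rewrite ?inE//.
    - by apply: measurableI => //; exact: measurableC.
    - exact: measurableD.
    by move=> x [Dx nD]; split=> // -[].
  rewrite measureD//; last by rewrite (le_lt_trans (probability_le1 _ _))// ltry.
  rewrite setIidr// [X in (_ - X)%E]e [X in (X - _)%E]DS subee//.
  exact: fin_num_measure.
have PC : P (~` [set x : Config R | odd_limit n x <= even_limit n x]) = 0%E.
  apply/negligibleP; first exact: measurableC.
  (* Enumerates the rationals, so that the null crossing events can be united countably. *)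
  pose q k : rat := odflt 0 (unpickle k).
  have N : P.-negligible (~` pos_set `|` \bigcup_k (D (q k) (n + 1) `&` ~` D (q k) n)).
    apply: negligibleU.
      by apply/negligibleP; [exact: measurableC|exact: PposC].
    apply: negligible_bigcup => k; apply/negligibleP; last exact: D0.
    by apply: measurableI => //; exact: measurableC.
  apply: negligibleS N => x /= /negP; rewrite -ltNge => LH.
  have [xp|?] := pselect (pos_set x); [right|by left].
  have := ratio_limit_le (n + 1) xp; rewrite addrK => lr.
  have : even_limit n x / odd_limit n x < even_limit (n + 1) x / odd_limit (n + 1) x.
    by rewrite (lt_leif lr) lt_eqF.
  move=> /rat_in_itvoo[r]; rewrite in_itv/= => /andP[r1 r2].
  exists (pickle r) => //; rewrite /q pickleK /=; split => //.
  by rewrite /D/=; apply/negP; rewrite -leNgt ltW.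
by rewrite -[X in P X]setCK probability_setC ?PC ?sube0//; exact: measurableC.
Qed.

Lemma equal_limits_ae : measurable equal_limits /\ P equal_limits = 1%E.
Proof.
have [mpos Ppos] := pos_set_ae Pmu mu_gt0.
have [mI PI] := probability_bigcap_int1 (fun n => (limits_ae_eq n).1)
  (fun n => (limits_ae_eq n).2).
by split; [exact: measurableI|rewrite probability_setI1].
Qed.

Lemma equal_limitsE x n : equal_limits x -> odd_limit n x = even_limit n x.
Proof.
move=> [xp /(_ n Logic.I) /= HL]; apply/eqP.
by rewrite eq_le HL even_le_odd_limit.
Qed.

(** Even iterates bound the law from one side and odd ones from the other; almost surely both have
    the same limit. *)
Lemma even_limit_law n (A : set R) : measurable A ->
  P [set x | A (even_limit n x)] = nu A.
Proof.
move=> mA; have mU := @measurable_even_limit n.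
have [mG PG] := equal_limits_ae.
have mit K (u : R) : measurable_fun setT (fun x : Config R => it K n x u).
  exact: measurable_iter_carrier.
have [m' m'E] := pushforward_restr_measure P mU measurableT.
transitivity (m' A); first by rewrite m'E setIT.
apply: measure_eq_rays mA => [|r|r s rs].
- by rewrite m'E preimage_setT setTI (le_lt_trans (probability_le1 _ _))// ltry.
- have mray := measurable_preimage mU (measurable_gtr_set r).
  rewrite m'E setIT -[leLHS](probability_setI1 mray mG PG).
  have dom : (P (\bigcup_k [set x | (r < it k.*2 n x 0)%R]) <= nu [set y | (r < y)%R])%E.
    apply: (domination_bigcup Pmu pres mu_gt0 nu_le0 (idx := double)).
      exact: measurable_gtr_set.
    move=> x u k K xp u0 kK /= rk; apply: lt_le_trans rk _.
    apply: le_trans (iter_even_le K n xp (ltW u0)).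
    exact: iter_even_nd.
  apply: le_trans dom; apply: le_measure; rewrite ?inE//.
  + exact: measurableI.
  + apply: bigcupT_measurable => K.
    exact: (measurable_preimage (mit _ 0) (measurable_gtr_set _)).
  move=> x [rx [xp _]]; apply: contrapT => nx; move: rx; apply/negP; rewrite -leNgt.
  have ic := @even_limit_cvg n x xp.
  rewrite -(cvg_lim _ ic)//; apply: limr_le; first by apply/cvg_ex; eexists; exact: ic.
  by apply: nearW => K; rewrite leNgt; apply/negP => rK; apply: nx; exists K.
have mU1 := measurable_preimage mU (measurable_ler_set r).
suff le_rs : (P [set x | (even_limit n x <= r)%R] <= nu [set y | (y < s)%R])%E.
  apply: (@le_trans _ _ (1 - nu [set y | (y < s)%R])%E).
    rewrite -probability_setC; last exact: measurable_ltr_set.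
    apply: le_measure; rewrite ?inE//.
    - exact: measurable_gtr_set.
    - by apply: measurableC; exact: measurable_ltr_set.
    by move=> y /= sy; apply/negP; rewrite -leNgt ltW.
  rewrite m'E setIT.
  rewrite [leRHS](_ : _ = 1 - P [set x | (even_limit n x <= r)%R])%E.
    exact: leeB.
  rewrite -probability_setC//.
  by congr (P _); apply/seteqP; split=> y /=; rewrite ltNge => /negP.
rewrite -[leLHS](probability_setI1 mU1 mG PG).
have dom : (P (\bigcup_k [set x | (it k.*2.+1 n x 0 < s)%R]) <= nu [set y | (y < s)%R])%E.
  apply: (domination_bigcup Pmu pres mu_gt0 nu_le0 (idx := fun k => k.*2.+1)).
    exact: measurable_ltr_set.
  move=> x u k K xp u0 kK ks.
  apply: le_lt_trans (iter_odd_ge K n xp (ltW u0)) _; apply: le_lt_trans ks.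
  exact: (iter_odd_ni n xp).
apply: le_trans dom; apply: le_measure; rewrite ?inE//.
+ exact: measurableI.
+ apply: bigcupT_measurable => K.
  exact: (measurable_preimage (mit _ 0) (measurable_ltr_set _)).
move=> x [rx xG]; have xp : pos_set x by case: xG.
apply: contrapT => nx.
have oc := @odd_limit_cvg n x xp.
have : s <= odd_limit n x.
  rewrite -(cvg_lim _ oc)//; apply: limr_ge; first by apply/cvg_ex; eexists; exact: oc.
  by apply: nearW => K; rewrite leNgt; apply/negP => rK; apply: nx; exists K.
rewrite (equal_limitsE n xG) => /le_lt_trans/(_ (le_lt_trans rx rs)).
by rewrite ltxx.
Qed.

End alpha0.

(** * Invariance *)

Section invariance.
Variable R : realType.
Implicit Types (a b : R) (x : Config R).

Lemma F_dK_involutive a b (y u : R) : 0 <= a -> 0 <= b -> 0 < y -> 0 < u ->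
  F_dK a b (F_dK a b y u).1 (F_dK a b y u).2 = (y, u).
Proof.
move=> a0 b0 y0 u0; rewrite {1}/F_dK.
have aff k : 0 <= k -> 1 + k * y * u != 0.
  by move=> k0; rewrite gt_eqF// ltr_wpDr// !mulr_ge0// ltW.
have e k : 1 + k * (F_dK a b y u).1 * (F_dK a b y u).2 = 1 + k * y * u.
  by rewrite /F_dK/=; field; rewrite !aff.
by rewrite !e /F_dK/=; congr pair; field; rewrite !aff.
Qed.

(** [dK_U] gives precedence to a unique family. If there is one, its row of carriers at time 0 is a
    carrier of [x], so both readings agree. *)
Lemma dK_U_unique_carrier a b x (U : int -> R) : dK_carrier a b x U ->
  unique_carrier a b x -> dK_U a b x = U.
Proof.
move=> cU [U0 [cU0 U0_uniq]]; have {}U0_uniq V : dK_carrier a b x V -> V = U.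
  by move=> cV; rewrite -(U0_uniq _ cV) (U0_uniq _ cU).
rewrite /dK_U; case: asboolP => [[p [fp _]]|_]; last first.
  by apply: U0_uniq; case: xgetP => [V -> //|/(_ U)].
case: xgetP => [[X V] -> /= [VXpos [VF X0]]|/(_ p)//].
apply: U0_uniq; split=> n; first by have [] := VXpos n 0.
by rewrite -(X0 n) VF.
Qed.

Lemma dK_U_unique_family a b x X U : dK_family a b x X U ->
  unique_family a b x -> forall n, dK_U a b x n = U n 0.
Proof.
move=> fXU uf n; rewrite /dK_U asboolT//; have [p [_ p_uniq]] := uf.
have e := p_uniq (X, U) fXU.
case: xgetP => [q -> fq|/(_ (X, U))//].
by rewrite -(p_uniq _ fq) e.
Qed.

(** Measurability and invariance are taken from a globally measurable [tau] which agrees with [T_dK]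
    on the full-measure set [E]. *)
Lemma dK_invariant_transport a b (P : probability (Config R) R)
  (tau : Config R -> Config R) (E : set (Config R)) :
  measurable E -> P E = 1%E -> measurable_fun setT tau ->
  (forall A, measurable A -> P (tau @^-1` A) = P A) ->
  (forall x, E x -> T_dK_dom a b x /\ forall n, T_dK a b x n = tau x n) ->
  dK_invariant a b P.
Proof.
move=> mE PE mtau tauP tauE; exists E; split=> // [x /tauE[]//|k n A mA].
have mcyl : measurable (cylinder n A).
  rewrite (_ : cylinder n A = \bigcap_(i in setT) (fun x : Config R => x (n i)) @^-1` A i).
    apply: fin_bigcap_measurable => [|i _]; first exact: finite_finset.
    exact: (measurable_preimage (@measurable_coord R (n i)) (mA i)).
  by apply/seteqP; split=> x Ax i; [move=> _|]; exact: Ax.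
have mtcyl := measurable_preimage mtau mcyl.
have -> : E `&` (T_dK a b @^-1` cylinder n A) = tau @^-1` cylinder n A `&` E.
  apply/seteqP; split=> x [].
    by move=> Ex Tx; split=> // i; have [_ <-] := tauE x Ex; exact: Tx.
  by move=> Tx Ex; split=> // i; rewrite /T_dK; have [_ e] := tauE x Ex;
    rewrite -/(T_dK a b x (n i)) e; exact: Tx.
by split; [exact: measurableI|rewrite probability_setI1// tauP].
Qed.

(** For equal parameters [F_dK] exchanges its arguments, so the only carrier is [x] itself and the
    dynamics is a shift. *)
Lemma dK_invariant_diag a (mu : probability R R) (P : probability (Config R) R) :
  0 <= a -> mu [set x : R | 0 < x] = 1%E -> iid_law P mu -> dK_invariant a a P.
Proof.
move=> a0 mu_gt0 Pmu; have [mpos Ppos] := pos_set_ae Pmu mu_gt0.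
have FE (y u : R) : 0 < y -> 0 < u -> F_dK a a y u = (u, y).
  move=> y0 u0; have aff : 1 + a * y * u != 0.
    by rewrite gt_eqF// ltr_wpDr// !mulr_ge0// ltW.
  by rewrite /F_dK !mulfK.
apply: (@dK_invariant_transport a a P (config_reindex (fun n => n - 1)) pos_set) => //.
- exact: measurable_config_reindex.
- by apply: (iid_reindex Pmu) => i j; exact: addIr.
move=> x xp.
have cx : dK_carrier a a x x by split=> // n; rewrite FE.
have ux : unique_carrier a a x.
  exists x; split=> // V [V0 VF]; apply/funext => n.
  by rewrite -(VF n) FE.
split; first by split=> //; right.
by move=> n; rewrite /T_dK (dK_U_unique_carrier cx ux) FE.
Qed.

Lemma dK_invariant_alpha0 b (mu nu : probability R R) (P : probability (Config R) R) :
  0 < b -> mu [set x : R | 0 < x] = 1%E -> nu [set u : R | u <= 0] = 0%E ->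
  iid_law P mu -> preserves_product 0 b mu nu -> dK_invariant 0 b P.
Proof.
move=> b0 mu_gt0 nu_le0 Pmu pres.
have [mG PG] := equal_limits_ae b0 Pmu mu_gt0.
have UG x : equal_limits b x -> forall n,
    even_limit b n x = (F_dK 0 b (x n) (even_limit b (n - 1) x)).2.
  move=> xG n; have xp : pos_set x by case: xG.
  by rewrite F_dK_alpha0 -(equal_limitsE b0 (n - 1) xG) -even_limit_rec.
apply: (@dK_invariant_transport 0 b P (transport 0 b (even_limit b)) (equal_limits b)) => //.
- by apply: measurable_transport; exact: measurable_even_limit.
- move=> A mA; apply: (transport_invariant Pmu pres _ _ _ mG PG UG mA).
  + exact: measurable_even_limit.
  + exact: even_limit_dep.
  + exact: (even_limit_law b0 Pmu pres).
move=> x xG; have xp : pos_set x by case: xG.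
have cx : dK_carrier 0 b x (fun n => even_limit b n x).
  by split=> n; [exact: even_limit_gt0|rewrite -UG].
have ux : unique_carrier 0 b x.
  exists (fun n => even_limit b n x); split=> // V [V0 VF]; apply/funext => n.
  have := carrier_between b0 n xp V0 VF; rewrite (equal_limitsE b0 n xG) -eq_le.
  by move/eqP.
split; first by split=> //; right.
by move=> n; rewrite /T_dK (dK_U_unique_carrier cx ux).
Qed.

(** * Uniqueness and existence of families when beta = 0 *)

Section beta0.
Variable a : R.
Hypothesis a0 : 0 < a.

Let lyapunov (u m v : R) := (u ^+ 2 * v + m) / (u - m).

Let lyapunov_step (x u m v : R) : 0 < x -> 0 < m -> m < u -> 0 < v ->
  let u1 := (F_dK a 0 x u).2 in let m1 := (F_dK a 0 x m).2 in
  let v1 := (F_dK a 0 (F_dK a 0 x u).1 v).2 in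
  lyapunov u m v + Num.min 1 a^-1 <= lyapunov u1 m1 v1.
Proof.
move=> x0 m0 mu v0; cbv zeta; rewrite !F_dK_beta0.
have u0 := lt_trans m0 mu.
have d0 : 0 < u - m by rewrite subr_gt0.
have -> : (F_dK a 0 x u).1 = u / (1 + a * x * u) by rewrite /F_dK/= !mul0r addr0 mulr1.
have D0 : 0 < 1 + a * x * u by rewrite ltr_wpDr// !mulr_ge0// ltW.
pose t := a * x * (u - m); have t0 : 0 < t by rewrite !mulr_gt0.
(* The increment is computed exactly: (u u1 + 1) / t, where u1 is the next value of the larger
   carrier. *)
have -> : lyapunov (x + a * x ^+ 2 * u) (x + a * x ^+ 2 * m)
   (u / (1 + a * x * u) + a * (u / (1 + a * x * u)) ^+ 2 * v) =
   lyapunov u m v + (u * (x + a * x ^+ 2 * u) + 1) / t.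
  rewrite /lyapunov /t; field; rewrite !gt_eqF//=.
  by rewrite (_ : _ - _ = a * x ^+ 2 * (u - m)) ?gt_eqF ?mulr_gt0 ?exprn_gt0//; ring.
rewrite lerD2l ler_pdivlMr//.
(* For t at most 1 the term 1/t already gives 1; for t > 1 this bound makes u u1 / t at least t/a,
   hence at least 1/a. *)
have tu : t * t <= a * (u * (x + a * x ^+ 2 * u)).
  rewrite /t (_ : a * (u * _) = a * x * u + (a * x * u) * (a * x * u)); last ring.
  apply: ler_wpDl; first by rewrite !mulr_ge0// ltW.
  have le : a * x * (u - m) <= a * x * u by rewrite ler_pM2l ?mulr_gt0// gerBl ltW.
  by apply: ler_pM => //; exact: ltW.
have [t1|t1] := leP t 1.
  apply: (@le_trans _ _ (1 * t)); first by rewrite ler_pM2r// ge_min lexx.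
  rewrite mul1r (le_trans t1)// lerDr mulr_ge0 ?ltW//.
  by rewrite addr_gt0// !mulr_gt0// exprn_gt0.
apply: (@le_trans _ _ (a^-1 * t)); first by rewrite ler_pM2r// ge_min lexx orbT.
rewrite mulrC ler_pdivrMr// mulrC; apply: le_trans (_ : t * t <= _).
  by rewrite ler_peMr// ltW.
by apply: le_trans tu _; rewrite ler_pM2l// lerDl.
Qed.

(* If a configuration has two carriers, the larger one pushes the transported
   configuration out of the domain: it then has no carrier. *)
Lemma two_carriers_no_next (x U m V : int -> R) n :
  (forall k, 0 < x k) -> (forall k, 0 < U k) -> (forall k, 0 < m k) -> (forall k, 0 < V k) ->
  (forall k, (F_dK a 0 (x k) (U (k - 1))).2 = U k) ->
  (forall k, (F_dK a 0 (x k) (m (k - 1))).2 = m k) ->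
  (forall k, (F_dK a 0 (F_dK a 0 (x k) (U (k - 1))).1 (V (k - 1))).2 = V k) ->
  ~ (m n < U n).
Proof.
move=> x0 U0 m0 V0 UE mE VE mUn.
have dE k : U k - m k = a * x k ^+ 2 * (U (k - 1) - m (k - 1)).
  by rewrite -(UE k) -(mE k) !F_dK_beta0; ring.
(* The gap between two carriers is multiplied by the positive factor a x^2 at each site, so its sign
   propagates backwards. *)
have lt j : m (n - j%:Z) < U (n - j%:Z).
  elim: j => [|j IH]; first by rewrite subr0.
  rewrite -subr_gt0; have : 0 < U (n - j%:Z) - m (n - j%:Z) by rewrite subr_gt0.
  rewrite dE pmulr_rgt0 ?mulr_gt0 ?exprn_gt0//.
  by rewrite (_ : n - j%:Z - 1 = n - j.+1%:Z)//; lia.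
pose L k := lyapunov (U k) (m k) (V k).
have delta0 : 0 < Num.min 1 a^-1 by rewrite lt_min ltr01 invr_gt0.
have Lj j : L (n - j%:Z) + Num.min 1 a^-1 *+ j <= L n.
  elim: j => [|j IH]; first by rewrite subr0 mulr0n addr0.
  apply: le_trans IH; rewrite mulrS addrA lerD2r.
  have := lyapunov_step (x0 (n - j%:Z)) (m0 (n - j.+1%:Z)) (lt j.+1) (V0 (n - j.+1%:Z)).
  have -> : n - j.+1%:Z = n - j%:Z - 1 by lia.
  by cbv zeta; rewrite UE mE VE.
have L0 j : 0 <= L (n - j%:Z).
  by rewrite divr_ge0 ?subr_ge0 ?(ltW (lt j))// addr_ge0 ?mulr_ge0 ?exprn_ge0// ltW.
have Ln0 : 0 <= L n by have := L0 0%N; rewrite subr0.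
(* So many sites back that the accumulated increments exceed [L n], although the starting value is
   nonnegative. *)
pose j := Num.bound (L n / Num.min 1 a^-1).
have : L n / Num.min 1 a^-1 < j%:R by apply: archi_boundP; rewrite divr_ge0// ltW.
rewrite ltr_pdivrMr// mulr_natl ltNge => /negP; apply.
by apply: le_trans (Lj j); rewrite lerDr.
Qed.

(** Row t + 1 of the first family supplies a carrier of the configuration transported by [U^~ t],
    which [two_carriers_no_next] forbids if [U n t] is the larger value. *)
Lemma family_carrier_le x y X U X' U' t n : dK_family a 0 x X U -> dK_family a 0 y X' U' ->
  (forall k, X k t = X' k t) -> U n t <= U' n t.
Proof.
move=> [pos [FE _]] [pos' [FE' _]] XX'; rewrite leNgt; apply/negP.
apply: (@two_carriers_no_next (X^~ t) (U^~ t) (U'^~ t) (U^~ (t + 1))) => k.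
- by have [] := pos k t.
- by have [] := pos k t.
- by have [] := pos' k t.
- by have [] := pos k (t + 1).
- by rewrite FE.
- by rewrite XX' FE'.
- by rewrite FE -[LHS]/(F_dK a 0 (X k (t + 1)) (U (k - 1) (t + 1))).2 FE.
Qed.

Lemma family_step x y X U X' U' t : dK_family a 0 x X U -> dK_family a 0 y X' U' ->
  (forall n, X n t = X' n t) ->
  (forall n, U n t = U' n t) /\ (forall n, X n (t + 1) = X' n (t + 1)).
Proof.
move=> f f' XX'.
have UU' n : U n t = U' n t.
  apply/eqP; rewrite eq_le (family_carrier_le n f f' XX').
  by rewrite (family_carrier_le n f' f)// => k; rewrite XX'.
split=> // n; have [[_ [FE _]] [_ [FE' _]]] := (f, f').
by have := FE n t; rewrite XX' UU' FE' => -[].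
Qed.

Lemma family_forward x X U X' U' : dK_family a 0 x X U -> dK_family a 0 x X' U' ->
  forall (t : nat) n, X n t%:Z = X' n t%:Z /\ U n t%:Z = U' n t%:Z.
Proof.
move=> f f' t.
have XX' : forall n, X n t%:Z = X' n t%:Z.
  elim: t => [|t IH] n; first by have [[_ [_ ->]] [_ [_ ->]]] := (f, f').
  have [_ e] := family_step f f' IH.
  by rewrite (_ : t.+1%:Z = t%:Z + 1)//; lia.
by move=> n; split => //; have [-> _] := family_step f f' XX'.
Qed.

(* Time reversal combined with space reflection maps families to families since
   [F_dK] is an involution. *)
Lemma family_reverse x X U : dK_family a 0 x X U ->
  dK_family a 0 (fun n => x (- n)) (fun n t => X (- n) (- t)) (fun n t => U (- n - 1) (- t - 1)).
Proof.
move=> [pos [FE X0]]; split; [|split] => [n t|n t|n].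
- by split; [have [] := pos (- n) (- t)|have [] := pos (- n - 1) (- t - 1)].
- have [Xp _] := pos (- n) (- t - 1); have [_ Up] := pos (- n - 1) (- t - 1).
  have := FE (- n) (- t - 1); rewrite subrK => e1.
  have := F_dK_involutive (ltW a0) (lexx 0) Xp Up; rewrite e1 => e.
  rewrite (_ : - (n - 1) - 1 = - n); last lia.
  by rewrite [LHS]e; congr (X _ _, _); lia.
- by rewrite oppr0 X0.
Qed.

(** Nonnegative times are covered by [family_forward], negative ones by the same statement for the
    reversed families. *)
Lemma family_unique x X U X' U' : dK_family a 0 x X U -> dK_family a 0 x X' U' ->
  (X, U) = (X', U').
Proof.
move=> f f'; have fw := family_forward f f'.
have bw := family_forward (family_reverse f) (family_reverse f').
congr pair; apply/funext => n; apply/funext => -[t|t].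
- by have [] := fw t n.
- by have [+ _] := bw t.+1 (- n); rewrite !opprK NegzE.
- by have [] := fw t n.
- have e1 : - (- n - 1) - 1 = n by lia.
  have e2 : - t%:Z - 1 = Negz t by rewrite NegzE; lia.
  by have [_] := bw t (- n - 1); rewrite e1 e2.
Qed.

Local Notation lim := (limit_carrier a 0).
Let tau : Config R -> Config R := transport a 0 lim.
Let refl : Config R -> Config R := config_reindex (fun n : int => - n).

Definition orbit_set : set (Config R) := \bigcap_k
  ((fun x => iter k tau x) @^-1` bounded_iter a `&`
   (fun x => iter k tau (refl x)) @^-1` bounded_iter a).

Let tau_F x : bounded_iter a x -> forall n, F_dK a 0 (x n) (lim (n - 1) x) = (tau x n, lim n x).
Proof.
by move=> xG n; rewrite (limit_carrier_rec (ltW a0) n xG) /tau /transport -surjective_pairing.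
Qed.

(** Negative times are the reflected orbit run backwards. [Negz k] stands for -(k+1), so [orbit_X]
    takes k + 1 steps, while [orbit_U] takes k: the carrier at time t joins the rows t and t + 1. *)
Definition orbit_X x (n t : int) : R :=
  match t with Posz k => iter k tau x n | Negz k => iter k.+1 tau (refl x) (- n) end.

Definition orbit_U x (n t : int) : R :=
  match t with Posz k => lim n (iter k tau x)
  | Negz k => lim (- n - 1) (iter k tau (refl x)) end.

Lemma orbit_family x : orbit_set x -> dK_family a 0 x (orbit_X x) (orbit_U x).
Proof.
move=> xE.
have xG k : bounded_iter a (iter k tau x) by have [] := xE k Logic.I.
have xG' k : bounded_iter a (iter k tau (refl x)) by have [] := xE k Logic.I.
have lim0 n y : bounded_iter a y -> 0 < lim n y.
  by move=> yG; exact: (limit_carrier_gt0 (ltW a0)).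
have pos y n : bounded_iter a y -> 0 < y n by case=> + _; exact.
split; [|split] => // [n [k|k]|n [k|k]].
- by split; [exact: (pos _ n (xG k))|exact: (lim0 n _ (xG k))].
- by split; [exact: (pos _ _ (xG' k.+1))|exact: (lim0 _ _ (xG' k))].
- rewrite (_ : k%:Z + 1 = k.+1%:Z); last lia.
  exact: (tau_F (xG k) n).
have := tau_F (xG' k) (- n) => e.
have [yp vp] : 0 < iter k tau (refl x) (- n) /\ 0 < lim (- n - 1) (iter k tau (refl x)).
  by split; [exact: (pos _ _ (xG' k))|exact: (lim0 _ _ (xG' k))].
have := F_dK_involutive (ltW a0) (lexx 0) yp vp; rewrite e => e'.
rewrite /orbit_U (_ : - (n - 1) - 1 = - n); last lia.
rewrite [LHS]e'; congr (_, _).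
(* From time -1 the next row is time 0, where the double reflection gives [x] back; earlier times
   stay within the reflected orbit. *)
case: k {e e' yp vp} => [|k]; first by rewrite /= /refl /config_reindex opprK.
by rewrite (_ : Negz k.+1 + 1 = Negz k)//; lia.
Qed.

Lemma dK_invariant_beta0 (mu nu : probability R R) (P : probability (Config R) R) :
  mu [set x : R | 0 < x] = 1%E -> nu [set u : R | u <= 0] = 0%E ->
  iid_law P mu -> preserves_product a 0 mu nu -> dK_invariant a 0 P.
Proof.
move=> mu_gt0 nu_le0 Pmu pres.
have [mG PG] := bounded_iter_ae (ltW a0) Pmu pres mu_gt0 nu_le0.
have mtau : measurable_fun setT tau.
  by apply: measurable_transport; exact: measurable_limit_carrier.
have tauP A : measurable A -> P (tau @^-1` A) = P A.
  move=> mA; apply: (transport_invariant Pmu pres _ _ _ mG PG _ mA).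
  - exact: measurable_limit_carrier.
  - exact: limit_carrier_dep.
  - exact: (limit_carrier_law (ltW a0) Pmu pres mu_gt0 nu_le0).
  - by move=> x xG n; exact: (limit_carrier_rec (ltW a0)).
have mrefl : measurable_fun setT refl by exact: measurable_config_reindex.
have miter k : measurable_fun setT (fun x => iter k tau x).
  by elim: k => [|k IH]; [exact: measurable_id|exact: (measurableT_comp mtau IH)].
have Piter k A : measurable A -> P ((fun x => iter k tau x) @^-1` A) = P A.
  elim: k A => [//|k IH] A mA.
  rewrite -(tauP A mA) -(IH (tau @^-1` A))//.
  exact: measurable_preimage.
have mE1 k : measurable ((fun x => iter k tau x) @^-1` bounded_iter a).
  exact: measurable_preimage.
have mE2 k : measurable ((fun x => iter k tau (refl x)) @^-1` bounded_iter a).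
  exact: (measurable_preimage mrefl (mE1 k)).
(* Reflection is an injective reindexing, so it preserves [P], and the backward half of the orbit is
   as admissible as the forward half. *)
have PE2 k : P ((fun x => iter k tau (refl x)) @^-1` bounded_iter a) = 1%E.
  transitivity (P (refl @^-1` ((fun x => iter k tau x) @^-1` bounded_iter a))) => //.
  by rewrite (iid_reindex Pmu (@oppr_inj _) (mE1 k)) Piter.
apply: (@dK_invariant_transport a 0 P tau orbit_set) => //.
- by apply: bigcapT_measurable => k; exact: measurableI.
- apply: probability_bigcap1 => k; first exact: measurableI.
  by rewrite probability_setI1// Piter.
move=> x xE; have fx := orbit_family xE.
have ux : unique_family a 0 x.
  by exists (orbit_X x, orbit_U x); split=> // -[X' U'] /= f'; exact: (family_unique fx f').
split; first by split; [have [[xp _] _] := xE 0%N Logic.I|left].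
by move=> n; rewrite /T_dK (dK_U_unique_family fx ux).
Qed.

End beta0.
End invariance.

Unset Implicit Arguments.

Theorem theorem3p12 (R : realType) (a b : R)
    (mu : probability R R) (P : probability (Config R) R) :
  0 <= a -> 0 <= b ->
  mu [set x : R | 0 < x] = 1%E ->
  iid_law P mu ->
  (a = b
   \/ (0 < a /\ b = 0 /\
       exists lam c : R, [/\ 0 < lam, 0 < c,
         has_density_prop mu (GIG_density lam (c * a) c) &
         log_moment_cond mu a])
   \/ (a = 0 /\ 0 < b /\
       exists lam c : R, [/\ 0 < lam, 0 < c,
         has_density_prop mu (IG_density lam c) &
         log_moment_cond mu b])) ->
  dK_invariant a b P.
Proof.
move=> a0 b0 mu_gt0 Pmu [<-|[[a_gt0 [-> [lam [c [lam0 c0 dmu _]]]]]|[-> [b_gt0 [lam [c [lam0 c0 dmu _]]]]]]].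
- exact: (dK_invariant_diag a0 mu_gt0 Pmu).
- have [nu [nu_le0 pres]] := GIG_preserves_product a_gt0 lam0 c0 dmu.
  exact: (dK_invariant_beta0 a_gt0 mu_gt0 nu_le0 Pmu pres).
- have [nu [nu_le0 pres]] := IG_preserves_product b_gt0 lam0 c0 dmu.
  exact: (dK_invariant_alpha0 b_gt0 mu_gt0 nu_le0 Pmu pres).
Qed.
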